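(* There exist absolute constants $K>0$ and $C>0$ such that for all positive integers $k$ and all real $x\ge 2$, \[ \#\Big\{ n\in\mathbb{N} : 4<n\le x,\ n-1 \text{ and } n+1 \text{ are both prime},\ \omega\Big(\frac n6\Big)=k\Big\} \le K\,x\,\frac{(\log\log x+C)^{k-1}}{(k-1)!\,(\log x)^3}. \]
   Context: $\omega(m)$ denotes the number of distinct prime factors of the positive integer $m$. Every integer $n>4$ with $n-1$ and $n+1$ both prime is divisible by $6$, so $n/6$ is a positive integer. The convention $0^0=1$ is used. *)

(* Defs.v *)
From mathcomp Require Import all_boot all_order all_algebra finmap.
From mathcomp Require Import all_classical reals exp.

Set Implicit Arguments.
Unset Strict Implicit.
Unset Printing Implicit Defensive.

Import Order.TTheory GRing.Theory Num.Theory.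

Local Open Scope classical_set_scope.
Local Open Scope ring_scope.

(* [primes m] is duplicate-free, so its size counts the distinct prime
   factors of m > 0. *)
Definition omega (m : nat) : nat := size (primes m).

(* Exact for the members of the set: 4 < n keeps [n - 1] from truncating, and
   n is then divisible by 6 (see [twin_middle_dvd6]). *)
Definition twin_middle (R : realType) (k : nat) (x : R) : set nat :=
  [set n : nat | [/\ (4 < n)%N, n%:R <= x, prime (n - 1), prime (n + 1)
                   & omega (n %/ 6) = k]].

Lemma twin_middle_dvd6 (n : nat) :
  (4 < n)%N -> prime (n - 1) -> prime (n + 1) -> (6 %| n)%N.
Proof.
move=> n4 pm pp.
have nd d m : (1 < d)%N -> prime m -> (d < m)%N -> ~~ (d %| m)%N.
  move=> d1 pr dm; apply/negP => /(primeP pr).2 /orP[] /eqP e; last first.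
    by rewrite e ltnn in dm.
  by rewrite e in d1.
have m3 : (3 < n - 1)%N by rewrite ltn_subRL.
have p3 : (3 < n + 1)%N by rewrite addn1 ltnS (leq_trans _ n4).
have nE : (n - 1 + 1 = n)%N by rewrite subnK // (leq_trans _ n4).
rewrite (@Gauss_dvd 2 3) //.
move: (nd 2 _ isT pm (ltnW m3)) (nd 3 _ isT pm m3) (nd 3 _ isT pp p3).
rewrite -nE; move: (n - 1)%N => m; rewrite addnK -addnA /dvdn.
rewrite -[((m + 1) %% 2)%N]modnDml -[((m + 1) %% 3)%N]modnDml.
rewrite -[((m + (1 + 1)) %% 3)%N]modnDml.
move: (ltn_pmod m (isT : 0 < 2)%N) (ltn_pmod m (isT : 0 < 3)%N).
by case: (m %% 2)%N => [|[|?]]; case: (m %% 3)%N => [|[|[|?]]].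
Qed.

(* [fset_set] is empty on infinite sets, so the count below relies on this. *)
Lemma finite_twin_middle (R : realType) (k : nat) (x : R) :
  finite_set (twin_middle k x).
Proof.
apply: (@sub_finite_set _ _ `I_(Num.truncn x).+1); last exact: finite_II.
move=> n [_ nx _ _ _] /=; rewrite ltnS.
by rewrite truncn_ge_nat // (le_trans _ nx).
Qed.

Definition twin_count (R : realType) (k : nat) (x : R) : nat :=
  #|` fset_set (twin_middle k x)|%fset.

(* Main.v *)
Require Import Defs.
From mathcomp Require Import all_boot all_order all_algebra finmap.
From mathcomp Require Import all_classical reals sequences exp.
From mathcomp Require Import ring lra zify.

(** Write [n = 6 * m]. If [P] is the largest prime factor of [m] and
    [m = d * P ^ a] with [P] prime to [d], then [d] has [k - 1] distinct
    prime factors, so the count is a sum over such [d] of the number of prime powers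
    [P ^ a <= x / (6 * d)] for which [6 * d * P ^ a - 1] and [6 * d * P ^ a + 1] are
    prime.

    For [a = 1] the three numbers [P], [6dP - 1] and [6dP + 1] are prime, and a
    sieve of dimension three ([twin_sieve]) bounds the number of [w < P <= y] by
    a constant times [singular d * y / (ln w)^3], where [singular d] is the
    product of [1 + 6 / p] over the primes dividing [d]. Powers with [a >= 2]
    are rare enough for a trivial bound ([twin_cofactor_sum]). The remaining sum
    of [singular d / d] over [d] with [k - 1] prime factors is an elementary
    symmetric function of the local sums [u p], the sum of
    [singular (p ^ a) / p ^ a] over [a >= 1]; it is at most the power [k - 1] of
    the sum of all [u p], divided by [(k - 1)!] ([smooth_sum_omega],
    [elem_sym_le]). Since [u p] is [1 / p] up to a summable error, the upper
    bound in the theorem of Mertens ([mertens2]) gives [(ln (ln x) + C)^(k - 1)].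

    The sieve only gains the cube of [ln w], which is weak when [P] is small
    compared with [x]. So [P] is localised in the classes
    [ln x / 2^(i+1) < ln P <= ln x / 2^i], in which the gain is
    [(ln x)^3 / 8^(i+1)]. For [m] above the square root of [x], the trick of
    Rankin inserts the factor [(m / sqrt x)^delta] with
    [delta = 2^i / (16 * ln x)]. All primes involved satisfy
    [delta * ln p <= 1 / 16], so the sum of the [u p] changes by a bounded amount
    ([rankin_smooth_sum]), while [x^(- delta / 2) = exp (- 2^i / 32)] more than
    compensates [8^i]. For [m] below the square root the loss [8^i] is at most a
    power of [ln x], hence harmless. The class bounds decrease like [2^(-i)]
    ([class_count_le]) and can be summed.

    The sieve is that of Brun and Hooley ([brun_hooley]). The sifting primes are
    cut into the blocks [8^(2^j) < p <= 8^(2^(j+1))], and the indicator of the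
    sifted set is bounded by the product over the blocks of Bonferroni sums
    truncated at an even level. The sum of [1 / p] over one block is bounded
    ([prime_recip_block]), so a level that grows linearly as the blocks get
    smaller makes the product of the truncation errors converge
    ([sieve_main_le]); since the sizes of the blocks decrease doubly
    exponentially, the moduli stay below a fixed power of the sifting limit
    ([sieve_error_le]). *)

Set Implicit Arguments.
Unset Strict Implicit.
Unset Printing Implicit Defensive.

Import Order.TTheory GRing.Theory Num.Theory.

Local Open Scope ring_scope.

(** * Elementary symmetric sums and Bonferroni truncation *)

Fixpoint elem_sym (R : numFieldType) (k : nat) (s : seq R) : R :=
  match k, s with
  | 0%N, _ => 1
  | _.+1, [::] => 0
  | k'.+1, x :: s' => elem_sym k s' + x * elem_sym k' s'
  end.

Lemma elem_sym0 (R : numFieldType) (s : seq R) : elem_sym 0 s = 1.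
Proof. by case: s. Qed.

Lemma exprD_ge_linear (R : numFieldType) (x y : R) n :
  0 <= x -> 0 <= y -> y ^+ n.+1 + n.+1%:R * x * y ^+ n <= (x + y) ^+ n.+1.
Proof.
move=> x0 y0; elim: n => [|n IH]; first by rewrite !expr1 expr0 mulr1 mul1r addrC.
rewrite [leRHS]exprS.
apply: le_trans (ler_wpM2l (addr_ge0 x0 y0) IH).
rewrite -subr_ge0.
have -> : (x + y) * (y ^+ n.+1 + n.+1%:R * x * y ^+ n) -
   (y ^+ n.+2 + n.+2%:R * x * y ^+ n.+1) = n.+1%:R * x ^+ 2 * y ^+ n.
  rewrite !exprS -[n.+2]addn1 natrD; ring.
by rewrite !mulr_ge0 ?exprn_ge0.
Qed.

(** Expanding the power of the sum, every square-free monomial of degree [k]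
    occurs [k!] times. The induction follows the recursion of [elem_sym] and only
    uses the first two terms of the binomial expansion. *)
Lemma elem_sym_le (R : numFieldType) k (s : seq R) :
  (forall x, x \in s -> 0 <= x) ->
  elem_sym k s <= (\sum_(x <- s) x) ^+ k / k`!%:R.
Proof.
elim: s k => [|x s IH] [|k] //= h; rewrite ?expr0 ?divr1 //.
  by rewrite big_nil expr0n mul0r.
have hs y : y \in s -> 0 <= y by move=> ys; apply: h; rewrite inE ys orbT.
have x0 : 0 <= x by apply: h; exact: mem_head.
have S0 : 0 <= \sum_(y <- s) y by rewrite big_seq sumr_ge0.
rewrite big_cons.
apply: le_trans (lerD (IH k.+1 hs) (ler_wpM2l x0 (IH k hs))) _.
rewrite ler_pdivlMr ?ltr0n ?fact_gt0 //.
apply: le_trans (exprD_ge_linear _ x0 S0).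
rewrite factS natrM le_eqVlt; apply/orP; left; apply/eqP.
set F := k`!%:R; have F0 : F != 0 by rewrite pnatr_eq0 -lt0n fact_gt0.
have k0 : k.+1%:R != 0 :> R by rewrite pnatr_eq0.
rewrite mulrDl; field; by rewrite F0 addrC natr1.
Qed.

Fixpoint sublists (s : seq nat) (b : nat) : seq (seq nat) :=
  if s is p :: s' then
    sublists s' b ++ (if b is b'.+1 then [seq p :: T | T <- sublists s' b'] else [::])
  else [:: [::]].

(** The part of degree at most [b] of the expanded product of [1 + x p]. Keeping
    the sublists explicit is what allows the same expansion to be evaluated later
    on indicators, on densities and on error terms. *)
Definition truncated_prod (R : numFieldType) (x : nat -> R) s b : R :=
  \sum_(T <- sublists s b) \prod_(p <- T) x p.

Lemma truncated_prod0 (R : numFieldType) (x : nat -> R) s : truncated_prod x s 0 = 1.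
Proof.
rewrite /truncated_prod; elim: s => [|p s IH] /=; last by rewrite cats0.
by rewrite big_seq1 big_nil.
Qed.

Lemma truncated_prodS (R : numFieldType) (x : nat -> R) p s b :
  truncated_prod x (p :: s) b.+1 = truncated_prod x s b.+1 + x p * truncated_prod x s b.
Proof.
rewrite /truncated_prod /= big_cat big_map /= big_distrr /=; congr (_ + _).
by apply: eq_bigr => T _; rewrite big_cons.
Qed.

(** Truncating the expansion of the product of [1 - x p] at degree [b] errs in the
    direction given by the parity of [b], by at most the first omitted term. Both
    bounds pass through the recursion on the list, since adjoining [p] combines
    the error at level [b] with [x p] times the error at level [b - 1], of
    opposite sign. *)
Lemma bonferroni (R : numFieldType) (x : nat -> R) s b :
  (forall p, p \in s -> 0 <= x p <= 1) ->
  0 <= (-1) ^+ b * (truncated_prod (fun p => - x p) s b - \prod_(p <- s) (1 - x p))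
    <= elem_sym b.+1 [seq x p | p <- s].
Proof.
elim: s b => [|p s IH] b h.
  rewrite big_nil /=; suff -> : truncated_prod (fun p => - x p) [::] b = 1 by rewrite subrr mulr0 lexx.
  by rewrite /truncated_prod /= big_seq1 big_nil.
have hs q : q \in s -> 0 <= x q <= 1 by move=> qs; apply: h; rewrite inE qs orbT.
have /andP[x0 x1] : 0 <= x p <= 1 by apply: h; exact: mem_head.
have P1 : 0 <= \prod_(q <- s) (1 - x q) <= 1.
  rewrite big_seq; apply/andP; split.
    by apply: prodr_ge0 => q /hs /andP[_ ?]; rewrite subr_ge0.
  apply: prodr_ile1 => q /hs /andP[? ?]; rewrite subr_ge0 gerBl; exact/andP.
rewrite big_cons; case: b => [|b].
  rewrite truncated_prod0 expr0 mul1r /= elem_sym0 mulr1.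
  have /andP[_] := IH 0%N hs; rewrite truncated_prod0 expr0 mul1r.
  move: (\prod_(j <- s) _) P1 (elem_sym 1 _) => P /andP[P0 P1] E /= hE.
  have xP : x p * P <= x p by rewrite ler_piMr.
  rewrite mulrBl mul1r opprB addrCA addrC; apply/andP; split.
    by rewrite addr_ge0 ?mulr_ge0 // subr_ge0.
  exact: lerD.
rewrite truncated_prodS.
have /andP[A1 A2] := IH b.+1 hs; have /andP[B1 B2] := IH b hs.
set P := \prod_(j <- s) _ in A1 A2 B1 B2 *.
set TS := truncated_prod _ _ b.+1 in A1 A2 *.
set TB := truncated_prod _ _ b in B1 B2 *.
have -> : (-1) ^+ b.+1 * (TS + - x p * TB - (1 - x p) * P) =
  (-1) ^+ b.+1 * (TS - P) + x p * ((-1) ^+ b * (TB - P)) by rewrite exprS; ring.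
apply/andP; split; first by rewrite addr_ge0 // mulr_ge0.
by apply: lerD => //; exact: ler_wpM2l.
Qed.

(** * Counting integers outside prescribed residue classes *)

(** From [N] to [N + 1] the quotient by [q] increases exactly when [N + (q - a)] is
    a multiple of [q]. *)
Lemma count_residueE (q a N : nat) : (a < q)%N ->
  (\sum_(m < N) (m %% q == a) = (N + (q - a.+1)) %/ q)%N.
Proof.
move=> aq; have q0 : (0 < q)%N by apply: leq_ltn_trans aq.
elim: N => [|N IH]; first by rewrite big_ord0 divn_small // ltn_subrL.
rewrite big_ord_recr /= IH addSn divnS // addnC; congr (_ + _)%N; congr nat_of_bool.
have -> : ((N + (q - a.+1)).+1 = N + (q - a))%N by rewrite -addnS -subSn // subSS.
rewrite -[in LHS](modn_small aq).
apply/eqP/idP => [e|].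
  by rewrite /dvdn -modnDml e modnDml subnKC ?modnn // ltnW.
move=> /dvdnP[c e]; have : (N + q = a + c * q)%N by rewrite -e addnCA subnKC // ltnW.
by move=> /(congr1 (modn^~ q)); rewrite modnDr addnC modnMDl.
Qed.

Lemma count_residue (R : realFieldType) (q a N : nat) : (0 < q)%N ->
  `| \sum_(m < N) ((m == a %[mod q]) : nat)%:R - N%:R / q%:R | <= 1 :> R.
Proof.
move=> q0; rewrite -natr_sum count_residueE ?ltn_mod //.
set c := (q - _)%N; have cq : (c < q)%N by rewrite ltn_subrL.
have q0R : 0 < q%:R :> R by rewrite ltr0n.
have := divn_eq (N + c) q; have := ltn_pmod (N + c) q0.
set D := ((N + c) %/ q)%N; set r := ((N + c) %% q)%N => rq e.
have -> : D%:R - N%:R / q%:R = (c%:R - r%:R) / q%:R :> R.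
  move: e => /(congr1 (fun n : nat => n%:R : R)); rewrite !natrD natrM => e.
  have -> : N%:R = D%:R * q%:R + r%:R - c%:R :> R by rewrite -e; ring.
  by field; rewrite gt_eqF.
rewrite normrM normfV (gtr0_norm q0R) ler_pdivrMr // mul1r ler_norml.
have : c%:R < q%:R :> R by rewrite ltr_nat.
have : r%:R < q%:R :> R by rewrite ltr_nat.
have : 0 <= c%:R :> R by []. have : 0 <= r%:R :> R by [].
by move=> *; apply/andP; split; lra.
Qed.

(** By the Chinese remainder theorem the conditions at the primes of [T] select a
    union of classes to the modulus [q] times the product of [T], each counted with
    error at most one. The extra class of [a] modulo [q] carries the induction: the
    head of [T] is absorbed into the modulus. *)
Lemma count_sieved_class (R : realFieldType) (res : nat -> seq nat) (T : seq nat) (N : nat) :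
  uniq T -> (forall p, p \in T -> prime p) ->
  (forall p, p \in T -> uniq (res p) && all (ltn^~ p) (res p)) ->
  forall q a, (0 < q)%N -> (forall p, p \in T -> coprime q p) ->
  `| \sum_(m < N) ((m == a %[mod q]) : nat)%:R * \prod_(p <- T) ((m %% p \in res p)%N : nat)%:R
     - N%:R / q%:R * \prod_(p <- T) ((size (res p))%:R / p%:R) |
  <= \prod_(p <- T) (size (res p))%:R :> R.
Proof.
elim: T => [|p T IH] /= uT pT rT q a q0 cT.
  rewrite !big_nil mulr1.
  under eq_bigr do rewrite big_nil mulr1.
  exact: count_residue.
have /andP[pnT uT'] := uT.
have pp : prime p by apply: pT; exact: mem_head.
have /andP[ur /allP ltr] : uniq (res p) && all (ltn^~ p) (res p) by apply: rT; exact: mem_head.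
have cqp : coprime q p by apply: cT; exact: mem_head.
have p0 := prime_gt0 pp.
have sub r : r \in T -> r \in p :: T by move=> h; rewrite inE h orbT.
pose f c (m : nat) : R := ((m == c %[mod q * p])%N : nat)%:R *
    \prod_(j <- T) ((m %% j \in res j)%N : nat)%:R.
have E1 (m : nat) : ((m == a %[mod q]) : nat)%:R *
    \prod_(j <- p :: T) ((m %% j \in res j)%N : nat)%:R =
    \sum_(r <- res p) f (chinese q p a r) m.
  rewrite big_cons mulrA /f -big_distrl /=; congr (_ * _).
  transitivity (\sum_(r <- res p) ((m == a %[mod q]) : nat)%:R * ((m %% p == r)%N : nat)%:R : R).
    rewrite -big_distrr /=; congr (_ * _).
    rewrite -natr_sum -(count_uniq_mem _ ur) -sum1_count big_mkcond /=.
    by congr (_%:R); apply: eq_bigr => r _; rewrite eq_sym; case: eqP.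
  rewrite big_seq [RHS]big_seq; apply: eq_bigr => r /ltr /= rp.
  rewrite chinese_remainder // chinese_modl // chinese_modr // -natrM mulnb.
  by rewrite (modn_small rp).
under eq_bigr do rewrite E1.
rewrite exchange_big /= !big_cons.
set W := \prod_(j <- T) _; set V := \prod_(j <- T) _.
have -> : N%:R / q%:R * ((size (res p))%:R / p%:R * W) =
    \sum_(r <- res p) (N%:R / (q * p)%:R * W).
  rewrite big_const_seq count_predT iter_addr_0 -mulr_natr natrM; field.
  by rewrite !pnatr_eq0 -!lt0n p0 q0.
rewrite -sumrB; apply: le_trans (ler_norm_sum _ _ _) _.
have -> : (size (res p))%:R * V = \sum_(r <- res p) V.
  by rewrite big_const_seq count_predT iter_addr_0 mulr_natl.
apply: ler_sum => r _; apply: IH => //.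
- by move=> j /sub; exact: pT.
- by move=> j /sub; exact: rT.
- by rewrite muln_gt0 q0 p0.
- move=> j jT; have pj : prime j by apply: pT; exact: sub.
  rewrite coprimeMl cT ?sub //= prime_coprime // dvdn_prime2 //.
  by apply: contraNneq pnT => ->.
Qed.

(** The sets of primes that occur when the truncated products of all blocks are
    multiplied out. *)
Fixpoint sieve_terms (bs : seq (seq nat * nat)) : seq (seq nat) :=
  if bs is (s, b) :: bs' then [seq T1 ++ T2 | T1 <- sublists s b, T2 <- sieve_terms bs']
  else [:: [::]].

Lemma sublists_subseq s b T : T \in sublists s b -> subseq T s.
Proof.
elim: s b T => [|p s IH] b T /=; first by rewrite inE => /eqP ->.
rewrite mem_cat => /orP[/IH h|].
  exact: (subseq_trans h (subseq_cons s p)).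
case: b => // b /mapP[T' /IH h ->]; by rewrite /= eqxx.
Qed.

Lemma sieve_terms_subseq bs T : T \in sieve_terms bs -> subseq T (flatten [seq b.1 | b <- bs]).
Proof.
elim: bs T => [|[s b] bs IH] T /=; first by rewrite inE => /eqP ->.
by case/allpairsP=> -[T1 T2] /= [/sublists_subseq h1 /IH h2 ->]; exact: cat_subseq.
Qed.

Lemma sieve_terms_prod (R : realFieldType) (x : nat -> R) bs :
  \sum_(T <- sieve_terms bs) \prod_(p <- T) x p = \prod_(b <- bs) truncated_prod x b.1 b.2.
Proof.
elim: bs => [|[s b] bs IH] /=; first by rewrite big_seq1 !big_nil.
rewrite big_cons /= -IH /truncated_prod big_distrlr /= big_allpairs_dep /=.
by apply: eq_bigr => T1 _; apply: eq_bigr => T2 _; rewrite big_cat.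
Qed.

(** Hooley's form of Brun's sieve. The indicator of the sifted set is a product of
    one factor per block; an even truncation bounds each factor from above, and it
    is nonnegative, so the bounds may be multiplied. Summing the expanded product
    over [m], each term has its main part in the first product and its error in the
    second. *)
Lemma brun_hooley (R : realFieldType) (res : nat -> seq nat) (bs : seq (seq nat * nat)) (N : nat) :
  let P := flatten [seq b.1 | b <- bs] in
  uniq P -> (forall p, p \in P -> prime p) ->
  (forall p, p \in P -> uniq (res p) && all (ltn^~ p) (res p)) ->
  (forall b, b \in bs -> ~~ odd b.2) ->
  (\sum_(m < N) (all (fun p => m %% p \notin res p)%N P : nat))%:R <=
    N%:R * (\prod_(b <- bs) truncated_prod (fun p => - ((size (res p))%:R / p%:R)) b.1 b.2)
    + \prod_(b <- bs) truncated_prod (fun p => (size (res p))%:R) b.1 b.2 :> R.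
Proof.
move=> P uP pP rP evb.
pose ind m p : R := ((m %% p \in res p)%N : nat)%:R.
have step (m : nat) : ((all (fun p => m %% p \notin res p)%N P : nat)%:R : R) <=
    \prod_(b <- bs) truncated_prod (fun p => - ind m p) b.1 b.2.
  have -> : (all (fun p => m %% p \notin res p)%N P : nat)%:R =
     \prod_(b <- bs) \prod_(p <- b.1) (1 - ind m p) :> R.
    rewrite /P; elim: (bs) => [|[s b] bs' IH]; first by rewrite big_nil.
    rewrite big_cons /= all_cat -mulnb natrM IH; congr (_ * _).
    elim: s => [|p s IHs] /=; first by rewrite big_nil.
    rewrite big_cons -IHs -mulnb natrM; congr (_ * _).
    by rewrite /ind; case: (_ \in _); rewrite ?subrr ?subr0.
  have i01 p : 0 <= ind m p <= 1.
    by rewrite /ind; case: (_ \in _); rewrite ?lexx ?ler01.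
  rewrite big_seq [leRHS]big_seq; apply: ler_prod => b /evb be.
  rewrite prodr_ge0 /=; last by move=> p _; have /andP[_] := i01 p; rewrite subr_ge0.
  have /andP[] := @bonferroni R (ind m) b.1 b.2 (fun p _ => i01 p).
  by rewrite -signr_odd (negbTE be) expr0 mul1r subr_ge0.
rewrite natr_sum; apply: le_trans (ler_sum _ (fun (m : 'I_N) _ => step m)) _.
under [leLHS]eq_bigr => m _ do rewrite -(sieve_terms_prod (fun p => - ind m p)).
rewrite exchange_big /= -(sieve_terms_prod (fun p => - ((size (res p))%:R / p%:R))).
rewrite -(sieve_terms_prod (fun p => (size (res p))%:R)) big_distrr -big_split /=.
rewrite big_seq [leRHS]big_seq; apply: ler_sum => T /sieve_terms_subseq sT.
have sTP p : p \in T -> p \in P by move=> h; exact: (mem_subseq sT).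
have sg (y : nat -> R) : \prod_(p <- T) (- y p) = (-1) ^+ size T * \prod_(p <- T) y p.
  elim: (T) => [|p T' IH] /=; first by rewrite !big_nil mulr1.
  by rewrite !big_cons IH exprS; ring.
under [leLHS]eq_bigr do rewrite sg.
rewrite sg -big_distrr /=.
have := @count_sieved_class R res T N (subseq_uniq sT uP) (fun p h => pP p (sTP p h))
   (fun p h => rP p (sTP p h)) 1%N 0%N isT (fun p _ => coprime1n p).
rewrite divr1.
under [X in `|X - _|]eq_bigr do rewrite !modn1 eqxx mul1r.
set A := \sum_(_ < _) _; set B := \prod_(_ <- _) (_ / _); set C := \prod_(_ <- _) _.
move=> h; rewrite mulrCA -lerBlDl -mulrBr.
apply: le_trans (ler_norm _) _.
by rewrite normrM normrX normrN normr1 expr1n mul1r.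
Qed.

(** * Sums over integers with prescribed prime factors *)

(** Reindexing along an injection whose image is not computed: all the
    decompositions of integers below are estimated in this way. *)
Lemma ler_sum_inj (R : numDomainType) (I J : finType) (P : pred I) (Q : pred J)
    (h : I -> J) (F : J -> R) :
  {in P &, injective h} -> (forall i, P i -> Q (h i)) -> (forall j, Q j -> 0 <= F j) ->
  \sum_(i | P i) F (h i) <= \sum_(j | Q j) F j.
Proof.
move=> hinj hPQ F0; rewrite -(big_imset F hinj) /=.
rewrite [leRHS](bigID (fun j => j \in [set h x | x in P])) /=.
rewrite (eq_bigl (fun j => Q j && (j \in [set h x | x in P]))); last first.
  by move=> j; case: imsetP => [[i Pi ->]|]; rewrite ?andbF // andbT; exact/esym/hPQ.
by rewrite lerDl sumr_ge0 // => j /andP[/F0].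
Qed.

Definition smooth (s : seq nat) (d : nat) : bool := (0 < d)%N && all (mem s) (primes d).

Lemma smooth_nil d : smooth [::] d = (d == 1)%N.
Proof.
rewrite /smooth; case: d => [|[|d]] //.
have : pdiv d.+2 \in primes d.+2 by rewrite mem_primes pdiv_prime ?pdiv_dvd.
by case: (primes _) => //= q l _.
Qed.

Lemma smooth_split p s d : prime p -> smooth (p :: s) d -> smooth s (d`_p^').
Proof.
move=> pp /andP[d0 /allP sd]; rewrite /smooth part_gt0; apply/allP => q.
rewrite primes_part mem_filter => /andP[qp /sd]; rewrite inE => /orP[] // /eqP qE.
by rewrite qE !inE eqxx in qp.
Qed.

(** Separate the power of [p] from the part prime to [p]. The ranges on the right
    are deliberately generous: only an upper bound is ever needed. *)
Lemma smooth_sum_cons (R : numDomainType) (p : nat) (s : seq nat) (X : nat) (phi : nat -> R) :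
  prime p -> (forall d, 0 <= phi d) ->
  \sum_(d < X.+1 | smooth (p :: s) d) phi d <=
    \sum_(a < X.+1) \sum_(d < X.+1 | smooth s d) phi (p ^ a * d)%N.
Proof.
move=> pp phi0.
rewrite pair_big_dep /=.
pose h (d : 'I_X.+1) : 'I_X.+1 * 'I_X.+1 := (inord (logn p d), inord (d`_p^')).
have hE (d : 'I_X.+1) : smooth (p :: s) d ->
    (nat_of_ord (h d).1 = logn p d) * (nat_of_ord (h d).2 = d`_p^')%N.
  move=> /andP[d0 _]; split; rewrite inordK //.
    by apply: leq_trans (ltn_logl p d0) (ltnW (ltn_ord d)).
  by apply: leq_ltn_trans (ltn_ord d); apply: dvdn_leq (dvdn_part _ _).
have hd (d : 'I_X.+1) : smooth (p :: s) d -> (p ^ (h d).1 * (h d).2 = d)%N.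
  by move=> sd; rewrite !hE // -p_part partnC //; case/andP: sd.
rewrite (eq_bigr (fun d => (fun u : 'I_X.+1 * 'I_X.+1 => phi (p ^ u.1 * u.2)%N) (h d))); last first.
  by move=> d sd /=; rewrite hd.
apply: (ler_sum_inj (F := fun u : 'I_X.+1 * 'I_X.+1 => phi (p ^ u.1 * u.2)%N)) => //=.
  by move=> d e sd se hde; apply/val_inj; rewrite /= -(hd d) // -(hd e) // hde.
by move=> d sd; rewrite hE // smooth_split.
Qed.

Lemma smooth_sum_nil (R : numDomainType) X (f : nat -> R) :
  0 <= f 1%N -> \sum_(d < X.+1 | smooth [::] d) f d <= f 1%N.
Proof.
move=> f1; case: X => [|X].
  by rewrite big_mkcond big_ord_recl big_ord0 /= addr0.
rewrite (big_pred1 (inord 1)) ?inordK // => d /=.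
by rewrite smooth_nil -val_eqE /= inordK.
Qed.

Lemma smooth_coprime p s d : prime p -> p \notin s -> smooth s d -> ~~ (p %| d)%N.
Proof.
move=> pp pns /andP[d0 /allP h]; apply/negP => pd.
by have := h p; rewrite mem_primes pp d0 pd => /(_ isT) /=; rewrite (negbTE pns).
Qed.

Lemma smooth_sum_prod (R : numFieldType) (s : seq nat) (X : nat) (f : nat -> R) :
  (forall p, p \in s -> prime p) -> uniq s -> (forall d, 0 <= f d) -> f 1%N = 1 ->
  (forall p a d, p \in s -> ~~ (p %| d)%N -> f (p ^ a * d)%N = f (p ^ a)%N * f d) ->
  \sum_(d < X.+1 | smooth s d) f d <= \prod_(p <- s) \sum_(a < X.+1) f (p ^ a)%N.
Proof.
move=> + + f0 f1; elim: s => [|p s IH] ps us fM.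
  by rewrite big_nil -f1; exact: smooth_sum_nil.
have pp : prime p by apply: ps; exact: mem_head.
have /andP[pns us'] := us.
have sub q : q \in s -> q \in p :: s by move=> h; rewrite inE h orbT.
have IH' := IH (fun q h => ps q (sub q h)) us' (fun q a d h => fM q a d (sub q h)).
apply: le_trans (smooth_sum_cons s X pp f0) _.
rewrite big_cons big_distrl /=; apply: ler_sum => a _.
apply: le_trans (ler_wpM2l (f0 _) IH'); rewrite big_distrr /=.
by apply: ler_sum => d sd; rewrite fM ?mem_head // (smooth_coprime pp pns sd).
Qed.

Lemma primes_primeX_mul p a d : prime p -> (0 < a)%N -> (0 < d)%N -> ~~ (p %| d)%N ->
  perm_eq (primes (p ^ a * d)) (p :: primes d).
Proof.
move=> pp a0 d0 pd; apply: uniq_perm; rewrite /= ?primes_uniq //.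
  by rewrite mem_primes pp d0 (negbTE pd).
move=> q; rewrite primesM ?expn_gt0 ?(prime_gt0 pp) // primesX // primes_prime //.
by rewrite !inE.
Qed.

(** The same Euler product argument, graded by the number of prime factors: taking
    a positive power of [p] raises the degree by one, which is the recursion of
    [elem_sym]. *)
Lemma smooth_sum_omega (R : numFieldType) (s : seq nat) (X k : nat) (f : nat -> R) :
  (forall p, p \in s -> prime p) -> uniq s -> (forall d, 0 <= f d) -> f 1%N = 1 ->
  (forall p a d, p \in s -> (0 < a)%N -> ~~ (p %| d)%N -> f (p ^ a * d)%N = f (p ^ a)%N * f d) ->
  \sum_(d < X.+1 | smooth s d && (size (primes d) == k)) f d <=
    elem_sym k [seq \sum_(a < X.+1 | (0 < a)%N) f (p ^ a)%N | p <- s].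
Proof.
move=> + + f0 f1; elim: s k => [|p s IH] k ps us fM /=.
  pose g d := if size (primes d) == k then f d else 0.
  rewrite big_mkcondr; apply: le_trans (@smooth_sum_nil _ X g _) _; rewrite /g /=; first by case: ifP.
  by rewrite f1; case: k {g}.
have pp : prime p by apply: ps; exact: mem_head.
have /andP[pns us'] := us.
have sub q : q \in s -> q \in p :: s by move=> h; rewrite inE h orbT.
have IH' j := IH j (fun q h => ps q (sub q h)) us' (fun q a d h => fM q a d (sub q h)).
pose phi d := if size (primes d) == k then f d else 0.
have phi0 d : 0 <= phi d by rewrite /phi; case: ifP.
rewrite big_mkcondr /=.
apply: le_trans (smooth_sum_cons s X pp phi0) _.
have sp d : smooth s d -> ~~ (p %| d)%N := smooth_coprime pp pns.
rewrite (bigID (fun a : 'I__ => (0 < a)%N)) /= addrC.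
have e0 : \sum_(a < X.+1 | ~~ (0 < a)%N) \sum_(d < X.+1 | smooth s d) phi (p ^ a * d)%N
   = \sum_(d < X.+1 | smooth s d && (size (primes d) == k)) f d.
  rewrite (big_pred1 ord0); last by move=> a /=; rewrite -val_eqE /= lt0n negbK.
  by rewrite [RHS]big_mkcondr; apply: eq_bigr => d _; rewrite expn0 mul1n.
rewrite e0 {e0}.
have prE a d : (0 < a)%N -> smooth s d -> size (primes (p ^ a * d)) = (size (primes d)).+1.
  move=> a0 sd; have d0 : (0 < d)%N by case/andP: sd.
  by have /perm_size := primes_primeX_mul pp a0 d0 (sp _ sd).
case: k @phi phi0 => [|k] phi phi0.
  have := IH' 0%N; rewrite elem_sym0 => h /=; rewrite [X in _ + X]big1 ?addr0 //.
  move=> a a0; apply: big1 => d sd; by rewrite /phi prE.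
apply: lerD; first exact: IH'.
apply: (@le_trans _ _ (\sum_(a < X.+1 | (0 < a)%N) (f (p ^ a)%N *
   \sum_(d < X.+1 | smooth s d && (size (primes d) == k)) f d))).
  rewrite le_eqVlt; apply/orP; left; apply/eqP; apply: eq_bigr => a a0.
  rewrite big_distrr [RHS]big_mkcondr /=; apply: eq_bigr => d sd.
  by rewrite /phi prE // eqSS; case: ifP => // _; rewrite fM ?mem_head ?sp.
rewrite -big_distrl /=; apply: ler_wpM2l (IH' k); by apply: sumr_ge0.
Qed.

(** * Estimates of Chebyshev, Mertens and Euler *)

Definition primes_in (m n : nat) : seq nat := [seq p <- iota m.+1 (n - m) | prime p].

Lemma mem_primes_in m n p : (p \in primes_in m n) = [&& prime p, (m < p)%N & (p <= n)%N].
Proof.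
rewrite mem_filter mem_iota; case: (prime p) => //=.
by apply/idP/idP => /andP[] *; apply/andP; split; lia.
Qed.

Lemma uniq_primes_in m n : uniq (primes_in m n).
Proof. by rewrite filter_uniq ?iota_uniq. Qed.

Lemma primes_in_cat m n r : (m <= n)%N -> (n <= r)%N ->
  primes_in m r = primes_in m n ++ primes_in n r.
Proof.
move=> mn nr; rewrite /primes_in -filter_cat; congr (seq.filter _ _).
have -> : (r - m = (n - m) + (r - n))%N by lia.
by rewrite iotaD; congr (_ ++ iota _ _); lia.
Qed.

Lemma primes_in_recr m n : (m <= n)%N ->
  primes_in m n.+1 = primes_in m n ++ (if prime n.+1 then [:: n.+1] else [::]).
Proof. by move=> mn; rewrite (primes_in_cat mn (leqnSn n)) {2}/primes_in subSnn. Qed.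

Lemma prod_prime_powers_dvd (s : seq nat) (e : nat -> nat) m :
  uniq s -> (forall p, p \in s -> prime p) -> (forall p, p \in s -> (p ^ e p %| m)%N) ->
  (\prod_(p <- s) p ^ e p %| m)%N.
Proof.
elim: s => [|p s IH] /=; first by rewrite big_nil dvd1n.
move=> /andP[pns us] ps pm.
have sub q : q \in s -> q \in p :: s by move=> h; rewrite inE h orbT.
rewrite big_cons Gauss_dvd; last first.
  rewrite big_seq; elim/big_ind: _ => [|x y hx hy|q qs].
  - exact: coprimen1.
  - by rewrite coprimeMr hx hy.
  - apply: coprimeXl; apply: coprimeXr; rewrite prime_coprime ?ps ?mem_head //.
    rewrite dvdn_prime2 ?ps ?mem_head // ?sub //.
    by apply: contraNneq pns => ->.
rewrite pm ?mem_head //=; apply: IH => // q qs; [apply: ps|apply: pm]; exact: sub.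
Qed.

Lemma prime_ndvd_fact p n : prime p -> (n < p)%N -> ~~ (p %| n`!)%N.
Proof.
move=> pp; elim: n => [|n IH] np; first by rewrite fact0 dvdn1 neq_ltn prime_gt1 ?orbT.
by rewrite factS Euclid_dvdM // negb_or IH ?(ltnW np) // andbT gtnNdvd.
Qed.

Lemma prime_dvd_bin p N h : prime p -> (h < p)%N -> (p <= N)%N -> (h <= N)%N ->
  (N - h <= h)%N -> (p %| 'C(N, h))%N.
Proof.
move=> pp hp pN hN Nh.
have : (p %| N`!)%N by rewrite dvdn_fact // prime_gt0.
rewrite -(bin_fact hN) !Euclid_dvdM // (negbTE (prime_ndvd_fact pp hp)).
by rewrite (negbTE (prime_ndvd_fact pp (leq_ltn_trans Nh hp))) /= !orbF.
Qed.

(** Chebyshev's bound, with a constant chosen for a short induction. *)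
Lemma primorial_le n : (\prod_(p <- primes_in 0 n) p <= 16 ^ n)%N.
Proof.
elim/ltn_ind: n => -[|[|n]] IH; try by rewrite /primes_in /= big_nil.
(* Every prime in the upper half divides this binomial coefficient, and
   16^h * 2^N <= 16^N because 4 * h + N <= 4 * N. *)
set h := uphalf n.+2; set N := n.+2 in h *.
have hN : (h <= N)%N by rewrite /h /N; lia.
have hN' : (h < N)%N by rewrite /h /N; lia.
have Nh : (N - h <= h)%N by rewrite /h /N; lia.
rewrite (primes_in_cat (leq0n h) hN) big_cat /=.
have d : (\prod_(p <- primes_in h N) p %| 'C(N, h))%N.
  rewrite (eq_bigr (fun p => p ^ 1)%N); last by move=> p _; rewrite expn1.
  apply: prod_prime_powers_dvd; first exact: uniq_primes_in.
    by move=> p; rewrite mem_primes_in => /andP[].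
  move=> p; rewrite mem_primes_in expn1 => /and3P[pp hp pN].
  exact: prime_dvd_bin hp pN hN Nh.
have C0 : (0 < 'C(N, h))%N by rewrite bin_gt0.
have C2 : ('C(N, h) <= 2 ^ N)%N.
  rewrite -[2%N]/(1 + 1)%N expnDn (bigD1 (inord h)) //= inordK //.
  by rewrite !exp1n !muln1 leq_addr.
apply: leq_trans (leq_mul (IH h hN') (leq_trans (dvdn_leq C0 d) C2)) _.
rewrite -[16%N]/(2 ^ 4)%N -!expnM -expnD leq_exp2l // /h /N; lia.
Qed.

Section Primes.
Variable R : realType.
Implicit Types (n m p : nat).

Lemma lnn_ge0 n : 0 <= ln (n%:R : R).
Proof. by case: n => [|n]; [rewrite ln0 | rewrite ln_ge0 // ler1n]. Qed.

Lemma ln_prod_nat (s : seq nat) (f : nat -> nat) : (forall p, p \in s -> (0 < f p)%N) ->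
  ln ((\prod_(p <- s) f p)%:R : R) = \sum_(p <- s) ln (f p)%:R.
Proof.
move=> f0; rewrite big_seq [RHS]big_seq.
suff: (0 < \prod_(p <- s | p \in s) f p)%N /\
   ln ((\prod_(p <- s | p \in s) f p)%:R : R) = \sum_(p <- s | p \in s) ln (f p)%:R by case.
apply: (big_ind2 (fun (x : nat) (y : R) => (0 < x)%N /\ ln x%:R = y)).
- by rewrite ln1.
- move=> x1 y1 x2 y2 [x10 <-] [x20 <-]; rewrite muln_gt0 x10 x20; split => //.
  by rewrite natrM lnM // posrE ltr0n.
- by move=> p ps; split => //; exact: f0.
Qed.

Lemma chebyshev_theta n : \sum_(p <- primes_in 0 n) ln (p%:R : R) <= n%:R * ln 16%:R.
Proof.
rewrite -ln_prod_nat; last by move=> p; rewrite mem_primes_in => /and3P[].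
rewrite [leRHS]mulr_natl -lnXn // -natrX ler_ln ?posrE ?ltr0n ?expn_gt0 // ?ler_nat ?primorial_le //.
by rewrite big_seq prodn_cond_gt0 // => p; rewrite mem_primes_in => /and3P[].
Qed.

Definition mertens_sum n : R := \sum_(p <- primes_in 0 n) ln (p%:R) / p%:R.

(** Compare with the factorial: [p ^ (n %/ p)] divides [n!] for each prime [p], and
    [ln n! <= n * ln n]. Replacing the integral part of [n / p] by [n / p] costs
    the Chebyshev sum. *)
Lemma mertens1 n : (0 < n)%N -> mertens_sum n <= ln n%:R + ln 16%:R.
Proof.
move=> n0; have n0R : 0 < n%:R :> R by rewrite ltr0n.
rewrite -(ler_pM2l n0R) mulrDr.
apply: (@le_trans _ _ (\sum_(p <- primes_in 0 n) ((n %/ p)%N%:R * ln p%:R + ln (p%:R : R)))).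
  rewrite big_distrr /= big_seq [leRHS]big_seq; apply: ler_sum => p.
  rewrite mem_primes_in => /and3P[_ p0 _].
  have p0R : 0 < p%:R :> R by rewrite ltr0n.
  have np : n%:R / p%:R <= (n %/ p)%N%:R + 1 :> R.
    rewrite ler_pdivrMr // natr1 -natrM ler_nat {1}(divn_eq n p) mulSn addnC.
    by rewrite leq_add2r ltnW // ltn_pmod.
  have := ler_wpM2r (lnn_ge0 p) np; rewrite mulrDl mul1r => h; apply: le_trans h.
  by rewrite mulrA mulrAC.
rewrite big_split /=; apply: lerD (chebyshev_theta n).
under eq_bigr => p _ do rewrite mulr_natl.
have -> : \sum_(p <- primes_in 0 n) ln (p%:R : R) *+ (n %/ p) =
  ln ((\prod_(p <- primes_in 0 n) p ^ (n %/ p))%N%:R).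
  rewrite ln_prod_nat; last by move=> p; rewrite mem_primes_in expn_gt0 => /and3P[_ ->].
  rewrite big_seq [RHS]big_seq; apply: eq_bigr => p; rewrite mem_primes_in => /and3P[_ p0 _].
  by rewrite natrX lnXn // ltr0n.
rewrite mulr_natl -lnXn // -natrX.
have d : (\prod_(p <- primes_in 0 n) p ^ (n %/ p) %| n`!)%N.
  apply: prod_prime_powers_dvd; first exact: uniq_primes_in.
    by move=> p; rewrite mem_primes_in => /andP[].
  move=> p; rewrite mem_primes_in => /and3P[pp p0 pn].
  rewrite pfactor_dvdn ?fact_gt0 // logn_fact // big_ltn ?expn1 ?leq_addr //.
have P0 : (0 < \prod_(p <- primes_in 0 n) p ^ (n %/ p))%N.
  by apply: dvdn_gt0 d; rewrite fact_gt0.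
rewrite ler_ln ?posrE ?ltr0n ?expn_gt0 ?n0 // ler_nat.
apply: leq_trans (dvdn_leq (fact_gt0 n) d) _.
elim: (n) => // k IH; rewrite factS expnS leq_mul2l /=.
apply: leq_trans IH _; case: k => // k; rewrite leq_exp2r // ltnW.
Qed.

Definition prime_recip_sum m n : R := \sum_(p <- primes_in m n) p%:R^-1.

(** This comparison of a relative increment with a logarithmic one serves to
    telescope the double logarithm in [mertens2]. *)
Lemma ln_le_lnln (a b : R) : 0 < a -> a <= b -> (b - a) / b <= ln b - ln a.
Proof.
move=> a0 ab; have b0 : 0 < b by exact: lt_le_trans ab.
have := @le_ln1Dx R (a / b - 1); rewrite addrCA subrr addr0 => h.
have : ln (a / b) <= a / b - 1 by apply: h; rewrite ltrBrDl subrr divr_gt0.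
rewrite ln_div ?posrE // mulrBl divff ?gt_eqF // => ?; lra.
Qed.

Lemma ln2_gt0 : 0 < ln (2 : R).
Proof. by rewrite ln_gt0 // ltr1n. Qed.

(** Partial summation from [mertens1]; the coefficient 1 of the double logarithm
    is essential, since this quantity is later raised to the power [k - 1]. *)
Lemma mertens2 : exists C : R, forall n, (1 < n)%N ->
  prime_recip_sum 0 n <= ln (ln n%:R) + C.
Proof.
pose c : R := ln 16%:R.
pose D n : R := ln n%:R + c - mertens_sum n.
pose C := prime_recip_sum 0 2 + D 2%N / ln 2%:R - ln (ln 2%:R).
exists C => n n1.
have D0 k : (0 < k)%N -> 0 <= D k by move=> k0; rewrite subr_ge0 mertens1.
have lnpos k : (1 < k)%N -> 0 < ln (k%:R : R) by move=> k1; rewrite ln_gt0 // ltr1n.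
(* Adding the slack D n / ln n makes the induction work: passing from n to n + 1,
   the term 1 / p of the sum cancels against the decrease of D. *)
suff h : prime_recip_sum 0 n + D n / ln n%:R <= ln (ln n%:R) + C.
  apply: le_trans h; rewrite lerDl divr_ge0 ?D0 ?(ltnW n1) // ltW // lnpos //.
elim: n n1 => // -[//|[_ _|n /(_ isT) IH _]].
  by rewrite /C addrCA subrr addr0.
move: IH; set m := n.+2 => IH.
pose e : R := if prime m.+1 then m.+1%:R^-1 else 0.
have S1 : prime_recip_sum 0 m.+1 = prime_recip_sum 0 m + e.
  rewrite /prime_recip_sum primes_in_recr // big_cat /=; congr (_ + _).
  by rewrite /e; case: ifP => _; rewrite ?big_seq1 ?big_nil.
have A1 : mertens_sum m.+1 = mertens_sum m + e * ln m.+1%:R.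
  rewrite /mertens_sum primes_in_recr // big_cat /=; congr (_ + _).
  by rewrite /e; case: ifP => _; rewrite ?big_seq1 ?big_nil ?mul0r // mulrC.
have lm := lnpos m isT; have lm1 := lnpos m.+1 isT.
have lmm : ln m%:R <= ln m.+1%:R :> R by rewrite ler_ln ?posrE ?ltr0n // ler_nat.
have key := ln_le_lnln lm lmm.
have DD : D m / ln m.+1%:R <= D m / ln m%:R.
  by apply: ler_wpM2l; rewrite ?D0 // lef_pV2 ?posrE.
have -> : prime_recip_sum 0 m.+1 + D m.+1 / ln m.+1%:R =
   prime_recip_sum 0 m + D m / ln m.+1%:R + (ln m.+1%:R - ln m%:R) / ln m.+1%:R.
  rewrite S1 /D A1; field; by rewrite gt_eqF.
lra.
Qed.

(** On the block, [1 / p] is at most [ln p / p] divided by [ln Z], while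
    [mertens1] at [Z ^ 2] gives [2 * ln Z + ln 16], and [ln 16 <= 2 * ln Z]. *)
Lemma prime_recip_block Z : (8 <= Z)%N -> prime_recip_sum Z (Z ^ 2) <= 4.
Proof.
move=> Z8; have lZ : 0 < ln (Z%:R : R) by rewrite ln_gt0 // ltr1n; lia.
have ZZ : (Z <= Z ^ 2)%N by rewrite -[X in (X <= _)%N]expn1 leq_exp2l //; lia.
rewrite -(ler_pM2r lZ) /prime_recip_sum big_distrl /=.
apply: (@le_trans _ _ (mertens_sum (Z ^ 2))).
  rewrite /mertens_sum (primes_in_cat (leq0n Z) ZZ) big_cat /=.
  apply: (@le_trans _ _ (\sum_(p <- primes_in Z (Z ^ 2)) ln p%:R / p%:R)).
    rewrite big_seq [leRHS]big_seq; apply: ler_sum => p.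
    rewrite mem_primes_in => /and3P[pp Zp _]; rewrite mulrC ler_wpM2r ?invr_ge0 //.
    by rewrite ler_ln ?posrE ?ltr0n ?ler_nat; lia.
  by rewrite lerDr sumr_ge0 // => p _; rewrite divr_ge0 // lnn_ge0.
apply: le_trans (mertens1 _) _; first by rewrite expn_gt0; lia.
rewrite natrX lnXn ?ltr0n; last lia.
have -> : 16%:R = 2 ^+ 4 :> R by rewrite -natrX.
rewrite lnXn ?ltr0n //.
have : ln (8%:R : R) <= ln Z%:R by rewrite ler_ln ?posrE ?ltr0n ?ler_nat //; lia.
have -> : 8%:R = 2 ^+ 3 :> R by rewrite -natrX.
rewrite lnXn ?ltr0n //; have := ln2_gt0; set l := ln 2; set z := ln _.
rewrite -(mulr_natl l) -(mulr_natl l 4) -(mulr_natl z) => ? ?; lra.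
Qed.

Lemma ln_le_harmonic n : ln n.+1%:R <= \sum_(1 <= d < n.+1) (d%:R^-1 : R).
Proof.
elim: n => [|n IH]; first by rewrite ln1 big_nil.
rewrite big_nat_recr //=.
have n0 : 0 < n.+1%:R :> R by rewrite ltr0n.
have -> : n.+2%:R = n.+1%:R * (1 + n.+1%:R^-1) :> R.
  by rewrite mulrDr mulr1 divff ?gt_eqF // natr1.
have i0 : 0 < n.+1%:R^-1 :> R by rewrite invr_gt0.
rewrite lnM ?posrE //; last by rewrite addr_gt0.
by apply: lerD => //; apply: le_ln1Dx; apply: lt_trans i0; rewrite ltrN10.
Qed.

(** Euler's argument: the inverse of the product is a product of geometric series,
    and its expansion contains [1 / d] for all [d <= n]. *)
Lemma euler_prod_le n : (1 < n)%N ->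
  \prod_(p <- primes_in 0 n) (1 - p%:R^-1) <= (ln n%:R)^-1 :> R.
Proof.
move=> n1; have ln0 : 0 < ln (n%:R : R) by rewrite ln_gt0 // ltr1n.
have pr p : p \in primes_in 0 n -> prime p by rewrite mem_primes_in => /andP[].
have f01 p : p \in primes_in 0 n -> 0 < 1 - p%:R^-1 :> R.
  move=> /pr /prime_gt1 p1; rewrite subr_gt0 invf_lt1 ?ltr1n // ltr0n; lia.
have P0 : 0 < \prod_(p <- primes_in 0 n) (1 - p%:R^-1) :> R.
  by rewrite big_seq; apply: prodr_gt0 => p; exact: f01.
rewrite -[leLHS]invrK lef_pV2 ?posrE ?invr_gt0 //.
apply: (@le_trans _ _ (\prod_(p <- primes_in 0 n) \sum_(a < n.+1) ((p ^ a)%N%:R^-1 : R))); last first.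
  rewrite -prodfV big_seq [leRHS]big_seq; apply: ler_prod => p pin.
  rewrite sumr_ge0 /=; last by move=> a _; rewrite invr_ge0.
  have p1 := f01 p pin.
  rewrite -[leRHS]mul1r ler_pdivlMr //.
  have -> : \sum_(a < n.+1) ((p ^ a)%N%:R^-1 : R) = \sum_(a < n.+1) (p%:R^-1) ^+ a.
    by apply: eq_bigr => a _; rewrite natrX exprVn.
  rewrite mulrC -[X in X * _]opprB mulNr -subrX1 opprB.
  by rewrite gerBl exprn_ge0 // invr_ge0.
apply: (@le_trans _ _ (\sum_(d < n.+1 | smooth (primes_in 0 n) d) ((d : nat)%:R^-1 : R))); last first.
  apply: (@smooth_sum_prod _ _ n (fun d => d%:R^-1)); rewrite ?uniq_primes_in ?invr1 //.
  - by move=> d; rewrite invr_ge0.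
  - by move=> p a d _ _; rewrite natrM invfM.
apply: (@le_trans _ _ (ln n.+1%:R)); first by rewrite ler_ln ?posrE ?ltr0n ?ler_nat //; lia.
apply: le_trans (ln_le_harmonic n) _.
rewrite -(big_mkord (smooth _) (fun d => d%:R^-1)) big_ltn_cond //=.
rewrite [leRHS]big_mkcond /= big_nat [leRHS]big_nat; apply: ler_sum => d /andP[d0 dn].
rewrite /smooth d0 /=; case: allP => // -[] q; rewrite mem_primes => /and3P[pq _ qd] /=.
by rewrite mem_primes_in pq prime_gt0 //= (leq_trans (dvdn_leq d0 qd)).
Qed.
End Primes.

(** * An upper bound sieve for the primes P with 6dP - 1 and 6dP + 1 prime *)

Definition sieve_lim (j : nat) : nat := (8 ^ 2 ^ j)%N.

Lemma sieve_limS j : sieve_lim j.+1 = (sieve_lim j ^ 2)%N.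
Proof. by rewrite /sieve_lim expnSr expnM. Qed.

Lemma sieve_lim_ge8 j : (8 <= sieve_lim j)%N.
Proof. by rewrite -[X in (X <= _)%N]/(8 ^ 1)%N leq_exp2l // expn_gt0. Qed.

Lemma sieve_lim_le j : (sieve_lim j <= sieve_lim j.+1)%N.
Proof. by rewrite leq_exp2l // leq_exp2l. Qed.

(** Block [j] out of [t]: the level grows by two as the blocks get smaller, and
    vanishes on the top block. *)
Definition sieve_block (t j : nat) : seq nat * nat :=
  (primes_in (sieve_lim j) (sieve_lim j.+1), (t - j.+1).*2).

Definition sieve_blocks t := [seq sieve_block t j | j <- index_iota 0 t].

Lemma flatten_sieve_blocks t :
  flatten [seq b.1 | b <- sieve_blocks t] = primes_in 8 (sieve_lim t).
Proof.
rewrite /sieve_blocks -map_comp /index_iota subn0.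
suff: forall t', (8 <= sieve_lim t')%N /\
   flatten [seq (fst \o sieve_block t) j | j <- iota 0 t'] = primes_in 8 (sieve_lim t').
  by move=> /(_ t) [].
elim=> [|t' [IH8 IH]]; first by split => //; rewrite /primes_in subnn.
split; first exact: sieve_lim_ge8.
rewrite -addn1 iotaD map_cat flatten_cat IH /= cats0 addn1 add0n.
by rewrite -primes_in_cat // sieve_lim_le.
Qed.

(** Residues modulo [p] that a prime [m > p] with [6dm - 1] and [6dm + 1] prime has
    to avoid: 0, the inverse of [6d] and its negative. *)
Definition twin_residues (d p : nat) : seq nat :=
  if (p %| 6 * d)%N then [:: 0%N]
  else let u := ((egcdn (6 * d) p).1 %% p)%N in [:: 0%N; u; (p - u)%N].

Definition twin_multiple (d m : nat) : bool :=
  [&& prime m, prime (6 * d * m).-1 & prime (6 * d * m).+1].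

Lemma twin_inverse d p : prime p -> ~~ (p %| 6 * d)%N ->
  let u := ((egcdn (6 * d) p).1 %% p)%N in
  [/\ (0 < u)%N, (u < p)%N & 6 * d * u = 1 %[mod p]].
Proof.
move=> pp pd u.
have d0 : (0 < 6 * d)%N by case: posnP pd => // ->; rewrite dvdn0.
have e1 : 6 * d * u = 1 %[mod p].
  rewrite /u modnMmr; case: (egcdnP p d0) => a b /= e _.
  have /eqP g : coprime (6 * d) p by rewrite coprime_sym prime_coprime.
  by rewrite mulnC e g modnMDl.
have up : (u < p)%N by rewrite ltn_mod prime_gt0.
split => //; rewrite lt0n; apply: contraTneq isT => u0.
by move: e1; rewrite u0 muln0 mod0n modn_small ?prime_gt1.
Qed.

Lemma twin_residues_uniq d p : prime p -> (8 < p)%N ->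
  uniq (twin_residues d p) && all (ltn^~ p) (twin_residues d p).
Proof.
move=> pp p8; rewrite /twin_residues; case: ifPn => pd /=; first by rewrite prime_gt0.
have [u0 up _] := twin_inverse pp pd; move: u0 up; set u := (_ %% p)%N => u0 up.
have op : odd p by case: (even_prime pp) => // e; rewrite e in p8.
rewrite !inE !negb_or.
apply/andP; split; last by apply/and4P; split => //; lia.
by apply/and3P; split => //; lia.
Qed.

Lemma twin_residues_size d p :
  size (twin_residues d p) = if (p %| 6 * d)%N then 1%N else 3%N.
Proof. by rewrite /twin_residues; case: ifP. Qed.

Lemma twin_multiple_sifted d m p : (0 < d)%N -> prime p -> (p < m)%N -> twin_multiple d m ->
  (m %% p)%N \notin twin_residues d p.
Proof.
move=> d0 pp pm /and3P[prm prl pru].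
have dm : (6 * m <= 6 * d * m)%N by rewrite -mulnA leq_mul2l leq_pmull.
have [X1 pl pu] : [/\ (0 < 6 * d * m)%N, (p < (6 * d * m).-1)%N & (p < (6 * d * m).+1)%N].
  by move: dm pm; clear; move: (6 * d * m)%N => X ? ?; split; lia.
have nd q : prime q -> (p < q)%N -> ~~ (p %| q)%N.
  by move=> pq pltq; rewrite dvdn_prime2 //; apply: contraTneq pltq => ->; rewrite ltnn.
have m0 : (m %% p != 0)%N by apply: nd.
rewrite /twin_residues; case: ifPn => pd; first by rewrite inE.
have [u0 up eu] := twin_inverse pp pd; move: u0 up eu; set u := (_ %% p)%N => u0 up eu.
rewrite !inE !negb_or m0 /=; apply/andP; split.
  apply: contra (nd _ prl pl) => /eqP e.
  rewrite -subn1 -eqn_mod_dvd //.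
  by rewrite -modnMmr e eu.
apply: contra (nd _ pru pu) => /eqP e.
rewrite -addn1 /dvdn -modnDmr -eu modnDmr -mulnDr -modnMmr -modnDml e.
by rewrite subnK ?modnn ?muln0 ?mod0n // ltnW.
Qed.

Lemma truncated_prod_le (R : numFieldType) (y : nat -> R) s b : (forall p, 0 <= y p) ->
  truncated_prod y s b <= (1 + \sum_(p <- s) y p) ^+ b.
Proof.
move=> y0; elim: s b => [|p s IH] [|b]; rewrite ?truncated_prod0 ?expr0 //.
  by rewrite /truncated_prod /= big_seq1 !big_nil addr0 expr1n.
rewrite truncated_prodS big_cons.
apply: le_trans (lerD (IH b.+1) (ler_wpM2l (y0 p) (IH b))) _.
set S := \sum_(j <- s) y j; have S0 : 0 <= S by apply: sumr_ge0.
rewrite exprS -mulrDl [leRHS]exprS.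
have -> : 1 + S + y p = 1 + (y p + S) by ring.
apply: ler_wpM2l; first by rewrite !addr_ge0.
by rewrite lerXn2r ?nnegrE ?addr_ge0 // lerD2l lerDr.
Qed.

Section SieveWeights.
Variable R : realType.

Lemma exprn_fact_le (x : R) n : 0 <= x -> x ^+ n / n`!%:R <= expR x.
Proof.
case: n => [|n] x0; first by rewrite expr0 divr1 -expR0 ler_expR.
by apply: le_trans (expR_ge1Dxn n x0); rewrite lerDr.
Qed.

Lemma expRN2_le (x : R) : 0 <= x <= 1 / 3 -> expR (- (2 * x)) <= 1 - x.
Proof.
move=> /andP[x0 x1]; rewrite expRN -[leLHS]mul1r ler_pdivrMr ?expR_gt0 //.
have := expR_ge1Dx (2 * x) => h.
have : (1 - x) * (1 + 2 * x) <= (1 - x) * expR (2 * x) by apply: ler_wpM2l => //; lra.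
apply: le_trans; nra.
Qed.

(** [bonferroni] bounds the truncation error by [M ^ (b+1) / (b+1)!], and the full
    product is at least [exp (- 2 * M)]; so the error is a small multiple of the
    product itself, and the estimate becomes multiplicative over the blocks. *)
Lemma truncated_prod_even_le (x : nat -> R) s b (M : R) : ~~ odd b ->
  (forall p, p \in s -> 0 <= x p <= 1 / 3) -> \sum_(p <- s) x p <= M ->
  0 <= truncated_prod (fun p => - x p) s b <=
    \prod_(p <- s) (1 - x p) * expR (expR (4 * M) * (2^-1) ^+ b.+1).
Proof.
move=> be x01 SM.
have S0 : 0 <= \sum_(p <- s) x p by rewrite big_seq sumr_ge0 // => p /x01 /andP[].
have M0 : 0 <= M by exact: le_trans SM.
have x01' p : p \in s -> 0 <= x p <= 1 by move=> /x01 /andP[-> h] /=; lra.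
have := bonferroni b x01'.
rewrite -signr_odd (negbTE be) expr0 mul1r => /andP[]; rewrite subr_ge0 lerBlDl => VT TE.
set V := \prod_(p <- s) _ in VT TE *; set T := truncated_prod _ _ _ in VT TE *.
have VE : expR (- (2 * M)) <= V.
  apply: (@le_trans _ _ (expR (- (2 * \sum_(p <- s) x p)))); first by rewrite ler_expR lerN2 ler_wpM2l.
  rewrite /V mulr_sumr -sumrN expR_sum big_seq [leRHS]big_seq; apply: ler_prod => p /x01 h.
  by rewrite expR_ge0 expRN2_le.
have V0 : 0 < V by apply: lt_le_trans VE; exact: expR_gt0.
apply/andP; split; first by apply: le_trans VT; exact: ltW.
apply: le_trans TE _.
apply: (@le_trans _ _ (V * (1 + expR (4 * M) * 2^-1 ^+ b.+1))); last first.
  by apply: ler_wpM2l; rewrite ?(ltW V0) // expR_ge1Dx.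
rewrite mulrDr mulr1 lerD2l.
apply: (@le_trans _ _ (M ^+ b.+1 / b.+1`!%:R)).
  apply: le_trans (elem_sym_le _ _) _; first by move=> y /mapP[p /x01 /andP[h _] ->].
  by rewrite big_map ler_wpM2r ?invr_ge0 // lerXn2r ?nnegrE.
(* Half of the base is traded for the factor 2^(-b-1), which is summable over blocks. *)
have -> : M ^+ b.+1 / b.+1`!%:R = (2 * M) ^+ b.+1 / b.+1`!%:R * 2^-1 ^+ b.+1.
  by rewrite mulrAC -exprMn mulrAC mulfV ?mul1r // pnatr_eq0.
rewrite mulrA; apply: ler_wpM2r; first by rewrite exprn_ge0 // invr_ge0.
apply: (@le_trans _ _ (expR (2 * M))); first by apply: exprn_fact_le; rewrite mulr_ge0.
apply: (@le_trans _ _ (expR (- (2 * M)) * expR (4 * M))).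
  by rewrite -expRD ler_expR; lra.
by apply: ler_wpM2r; rewrite ?expR_ge0.
Qed.

Lemma sum_half_pow_le t : \sum_(0 <= j < t) (2^-1 : R) ^+ (t - j) <= 1.
Proof.
suff -> : \sum_(0 <= j < t) (2^-1 : R) ^+ (t - j) = 1 - 2^-1 ^+ t.
  by rewrite gerBl exprn_ge0 // invr_ge0.
elim: t => [|t IH]; first by rewrite big_nil expr0 subrr.
rewrite big_nat_recl // subn0; under eq_bigr do rewrite subSS.
by rewrite IH exprS; field.
Qed.

Definition sieve_density (d p : nat) : R := (size (twin_residues d p))%:R / p%:R.

Lemma sieve_density_bound d p : (8 < p)%N -> 0 <= sieve_density d p <= 1 / 3.
Proof.
move=> p8; have p8R : 9%:R <= p%:R :> R by rewrite ler_nat.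
rewrite /sieve_density divr_ge0 //= ler_pdivrMr; last by lra.
by rewrite twin_residues_size; case: ifP => _; lra.
Qed.

(** The correction factors of the blocks are [exp (E * 2 ^ (- (t - j)))] at worst,
    and their product converges. *)
Lemma sieve_main_le d t :
  \prod_(b <- sieve_blocks t) truncated_prod (fun p => - sieve_density d p) b.1 b.2
  <= expR (expR 48) * \prod_(p <- primes_in 8 (sieve_lim t)) (1 - sieve_density d p).
Proof.
rewrite -flatten_sieve_blocks big_flatten /= /sieve_blocks !big_map.
apply: (@le_trans _ _ (\prod_(j <- index_iota 0 t)
   ((\prod_(p <- primes_in (sieve_lim j) (sieve_lim j.+1)) (1 - sieve_density d p)) *
    expR (expR 48 * 2^-1 ^+ (t - j))))).
  rewrite big_seq [leRHS]big_seq; apply: ler_prod => j; rewrite mem_index_iota => /andP[_ jt].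
  have x01 p : p \in primes_in (sieve_lim j) (sieve_lim j.+1) -> 0 <= sieve_density d p <= 1 / 3.
    rewrite mem_primes_in => /and3P[_ h _]; apply: sieve_density_bound.
    exact: leq_ltn_trans (sieve_lim_ge8 j) h.
  (* 12 = 3 * 4: at most three residues, and sum of 1/p at most 4 on a block. *)
  have SM : \sum_(p <- primes_in (sieve_lim j) (sieve_lim j.+1)) sieve_density d p <= 12.
    have := @prime_recip_block R _ (sieve_lim_ge8 j); rewrite -sieve_limS => h.
    apply: (@le_trans _ _ (3 * prime_recip_sum R (sieve_lim j) (sieve_lim j.+1))); last lra.
    rewrite /prime_recip_sum mulr_sumr; apply: ler_sum => p _.
    rewrite /sieve_density ler_wpM2r ?invr_ge0 // twin_residues_size.
    by case: ifP; rewrite ?ler1n.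
  have /andP[T0 TM] := @truncated_prod_even_le (sieve_density d) _ (t - j.+1).*2 12 (negbT (odd_double _)) x01 SM.
  rewrite T0 /=; apply: le_trans TM _; apply: ler_wpM2l.
    by rewrite big_seq; apply: prodr_ge0 => p /x01 /andP[_ h]; lra.
  rewrite ler_expR (_ : 4 * 12 = 48 :> R); last by rewrite -natrM.
  apply: ler_wpM2l; first exact: expR_ge0.
  by rewrite ler_wiXn2l ?invr_ge0 ?invf_le1 ?ler1n //; lia.
rewrite big_split /= mulrC; apply: ler_wpM2r.
  rewrite big_seq; apply: prodr_ge0 => j _; rewrite big_seq; apply: prodr_ge0 => p.
  rewrite mem_primes_in => /and3P[_ h _].
  have /(sieve_density_bound d) /andP[_] := leq_ltn_trans (sieve_lim_ge8 j) h; lra.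
rewrite -expR_sum ler_expR -mulr_sumr; apply: ler_piMr (sum_half_pow_le t); exact: expR_ge0.
Qed.

(** A block in [(Z, Z ^ 2]] offers fewer than [Z ^ 4] residue conditions in all,
    and the levels increase only linearly while the logarithms of the block sizes
    are halved, so the exponents add up to a bounded multiple of the top one. *)
Lemma sieve_error_le d t :
  \prod_(b <- sieve_blocks t) truncated_prod (fun p => (size (twin_residues d p))%:R) b.1 b.2
  <= (sieve_lim t ^ 8)%N%:R :> R.
Proof.
rewrite /sieve_blocks !big_map.
apply: (@le_trans _ _ (\prod_(j <- index_iota 0 t) (sieve_lim j.+1 ^ (2 * (t - j.+1).*2))%N%:R)).
  apply: ler_prod => j _; apply/andP; split.
    by apply: sumr_ge0 => T _; apply: prodr_ge0.
  apply: le_trans (truncated_prod_le _ _ _) _ => //=.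
  rewrite -natr_sum -[1]/(1%:R) -natrD -natrX ler_nat expnM.
  suff h : (1 + \sum_(p <- (sieve_block t j).1) size (twin_residues d p) <= sieve_lim j.+1 ^ 2)%N.
    by case: (_.*2) => // e; rewrite leq_exp2r.
  have h3 : (\sum_(p <- (sieve_block t j).1) size (twin_residues d p) <=
      3 * (sieve_lim j.+1 - sieve_lim j))%N.
    apply: (@leq_trans (\sum_(p <- (sieve_block t j).1) 3)).
      by apply: leq_sum => p _; rewrite twin_residues_size; case: ifP.
    rewrite big_const_seq count_predT iter_addn_0 leq_mul2l /= size_filter.
    by apply: leq_trans (count_size _ _) _; rewrite size_iota.
  have := sieve_lim_ge8 j; have := sieve_lim_le j; move: h3; clear.
  move: (sieve_lim j.+1) (sieve_lim j) => a b ? ? ?; nia.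
rewrite -natr_prod ler_nat /sieve_lim.
under eq_bigr do rewrite -expnM.
rewrite -expnM -expn_sum leq_exp2l //.
(* Exponents of 8: each block contributes its size squared to the power of its level. *)
suff: (\sum_(0 <= j < t) 2 ^ j.+1 * (t - j.+1) <= 2 ^ t.+1)%N.
  move=> h; apply: (@leq_trans (4 * 2 ^ t.+1)); last by rewrite expnS; lia.
  apply: leq_trans (leq_mul (leqnn 4) h); rewrite big_distrr /=.
  by apply: leq_sum => j _; rewrite -muln2; lia.
elim: t => [|t IH]; first by rewrite big_nil.
rewrite big_nat_recr //= subnn muln0 addn0.
have -> : (\sum_(0 <= j < t) 2 ^ j.+1 * (t.+1 - j.+1) =
   \sum_(0 <= j < t) 2 ^ j.+1 * (t - j.+1) + \sum_(0 <= j < t) 2 ^ j.+1)%N.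
  rewrite -big_split /=; apply: eq_big_nat => j /andP[_ jt].
  by rewrite (subSn jt) mulnS addnC.
have : (\sum_(0 <= j < t) 2 ^ j.+1 <= 2 ^ t.+1)%N.
  elim: (t) => [|k IHk]; first by rewrite big_nil.
  by rewrite big_nat_recr //= [leqRHS]expnS mul2n -addnn leq_add2r.
by move: IH => /leq_add /[apply] h; apply: leq_trans h _; rewrite [leqRHS]expnS mul2n -addnn.
Qed.
End SieveWeights.

Section TwinSieve.
Variable R : realType.

(** An upper bound for the factor by which the divisors of [d] enlarge the singular
    series: [1 + 6 / p] is at least [(1 - 1/p) ^ (-2)] for all primes, and
    [sieve_density_factor] uses it for [p > 8]. *)
Definition singular (d : nat) : R := \prod_(p <- primes d) (1 + 6 / p%:R).

Lemma singular_ge1 d : 1 <= singular d.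
Proof.
rewrite /singular; elim: (primes d) => [|p s IH]; first by rewrite big_nil.
by rewrite big_cons mulr_ege1 // lerDl divr_ge0.
Qed.

Lemma prod_sub_le (s u : seq nat) (F : nat -> R) : uniq s -> uniq u -> (forall p, 1 <= F p) ->
  \prod_(p <- s | p \in u) F p <= \prod_(p <- u) F p.
Proof.
move=> us uu F1; have F0 p : 0 <= F p by apply: le_trans (F1 p).
rewrite -big_filter (perm_big [seq p <- u | p \in s]) /=; last first.
  apply: uniq_perm; rewrite ?filter_uniq // => p.
  by rewrite !mem_filter andbC.
rewrite big_filter [leRHS](bigID (mem s)) /= ler_peMr ?prodr_ge0 //.
by apply: (big_ind (fun x => 1 <= x)) => // x y; exact: mulr_ege1.
Qed.

Lemma euler_prod_tail_le n : (8 < n)%N ->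
  \prod_(p <- primes_in 8 n) (1 - p%:R^-1) <= 5 / ln n%:R :> R.
Proof.
move=> n8; have := @euler_prod_le R n (leq_trans (isT : 1 < 9)%N n8).
rewrite (primes_in_cat (leq0n 8) (ltnW n8)) big_cat /=.
(* The factors at 2, 3, 5 and 7 multiply to 8 / 35, and 35 / 8 <= 5. *)
have -> : primes_in 0 8 = [:: 2; 3; 5; 7]%N by [].
rewrite !big_cons big_nil => h.
have := ler_wpM2l (ler0n R 5) h; apply: le_trans.
set P := \prod_(p <- _) _; have P0 : 0 <= P.
  rewrite /P big_seq; apply: prodr_ge0 => p; rewrite mem_primes_in => /andP[pp _].
  by rewrite subr_ge0 invf_le1 ?ler1n ?ltr0n ?prime_gt0.
have -> : 5%:R * ((1 - 2%:R^-1) * ((1 - 3%:R^-1) * ((1 - 5%:R^-1) * ((1 - 7%:R^-1) * 1))) * P)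
   = 8 / 7 * P by field.
lra.
Qed.

(** Comparison with dimension three: [1 - 3/p <= (1 - 1/p) ^ 3], and where only one
    residue is removed the two missing factors [1 - 1/p] are paid by [1 + 6/p]. *)
Lemma sieve_density_factor d p : (0 < d)%N -> prime p -> (8 < p)%N ->
  0 <= 1 - sieve_density R d p <=
    (1 - p%:R^-1) ^+ 3 * (if p \in primes d then 1 + 6 / p%:R else 1).
Proof.
move=> dpos pp p8; have /andP[d0 d1] := sieve_density_bound R d p8.
apply/andP; split; first by move: d1; lra.
have p9 : 9%:R <= p%:R :> R by rewrite ler_nat.
have pi0 : 0 < p%:R :> R by rewrite ltr0n prime_gt0.
set x := p%:R^-1 : R.
have x0 : 0 < x by rewrite invr_gt0.
have x9 : x <= 1 / 9 by rewrite /x -[leLHS]mul1r ler_pdivrMr //; lra.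
rewrite /sieve_density twin_residues_size -/x Euclid_dvdM //.
rewrite (_ : (p %| 6)%N = false) /=; last by apply: gtnNdvd => //; lia.
rewrite mem_primes pp dpos /=; case: ifP => _.
  suff : 0 <= (1 - x) * ((1 - x) ^+ 2 * (1 + 6 * x) - 1) by nra.
  apply: mulr_ge0; first lra.
  have -> : (1 - x) ^+ 2 * (1 + 6 * x) - 1 = x * (4 - 11 * x + 6 * x ^+ 2) by ring.
  by apply: mulr_ge0; nra.
by have := mulr_ge0 (sqr_ge0 x) (_ : 0 <= 3 - x); nra.
Qed.

Lemma sieve_density_prod_le d t : (0 < d)%N -> (0 < t)%N ->
  \prod_(p <- primes_in 8 (sieve_lim t)) (1 - sieve_density R d p) <=
    125 * singular d / ln (sieve_lim t)%:R ^+ 3.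
Proof.
move=> d0 t0; set s := primes_in 8 _.
have inS p : p \in s -> prime p /\ (8 < p)%N by rewrite mem_primes_in => /and3P[].
apply: (@le_trans _ _ (\prod_(p <- s) ((1 - p%:R^-1) ^+ 3 * (if p \in primes d then 1 + 6 / p%:R else 1)))).
  rewrite big_seq [leRHS]big_seq; apply: ler_prod => p /inS[pp p8].
  exact: sieve_density_factor.
have lim8 : (8 < sieve_lim t)%N.
  rewrite -(prednK t0) sieve_limS; have := sieve_lim_ge8 t.-1; nia.
have l0 : 0 < ln ((sieve_lim t)%:R : R) by rewrite ln_gt0 // ltr1n (leq_trans _ lim8).
rewrite big_split /= -big_mkcond /= prodrXl.
have s1 : \prod_(p <- s | p \in primes d) (1 + 6 / p%:R) <= singular d.
  apply: prod_sub_le; rewrite ?uniq_primes_in ?primes_uniq // => p.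
  by rewrite lerDl divr_ge0.
have P0 : 0 <= \prod_(p <- s) (1 - p%:R^-1) :> R.
  rewrite big_seq; apply: prodr_ge0 => p /inS[pp _].
  by rewrite subr_ge0 invf_le1 ?ler1n ?ltr0n ?prime_gt0.
have -> : 125 * singular d / ln (sieve_lim t)%:R ^+ 3 =
    (5 / ln (sieve_lim t)%:R) ^+ 3 * singular d.
  by field; rewrite gt_eqF.
apply: ler_pM => //; first exact: exprn_ge0.
  by apply: prodr_ge0 => p _; rewrite addr_ge0 // divr_ge0.
by rewrite lerXn2r ?nnegrE ?euler_prod_tail_le // divr_ge0 // ltW.
Qed.

(** The exponent 16 leaves room for the error term [sieve_lim t ^ 8], while the
    next level shows that [ln w] and [ln (sieve_lim t)] are comparable. *)
Lemma sieve_level (w : R) : (sieve_lim 1 ^ 16)%N%:R <= w ->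
  exists2 t, (0 < t)%N & (sieve_lim t ^ 16)%N%:R <= w < (sieve_lim t ^ 32)%N%:R.
Proof.
move=> w0; have wge0 : 0 <= w by apply: le_trans w0.
pose P t := (sieve_lim t ^ 16 <= Num.truncn w)%N.
have PE t : P t = ((sieve_lim t ^ 16)%N%:R <= w) by rewrite /P truncn_ge_nat.
have exP : exists t, P t by exists 1%N; rewrite PE.
have bdP t : P t -> (t <= Num.truncn w)%N.
  apply: leq_trans; apply: leq_trans (_ : sieve_lim t <= _)%N.
    by rewrite ltnW // (ltn_trans (ltn_expl t (isT : 1 < 2)%N)) // ltn_expl.
  by rewrite -[X in (X <= _)%N]expn1 leq_exp2l // (leq_trans _ (sieve_lim_ge8 t)).
case: (ex_maxnP exP bdP) => t Pt tmax.
have t0 : (0 < t)%N by apply: tmax; rewrite PE.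
exists t => //; rewrite -PE Pt /= ltNge.
have -> : (sieve_lim t ^ 32 = sieve_lim t.+1 ^ 16)%N by rewrite sieve_limS -expnM.
by rewrite -PE; apply/negP => /tmax; rewrite ltnn.
Qed.

Definition twin_multiple_count (d N : nat) (w : R) : nat :=
  \sum_(m < N.+1) ((w < m%:R)%R && twin_multiple d m).

Lemma sieve_count_le d t N (w : R) : (0 < d)%N -> (0 < t)%N -> (sieve_lim t)%:R <= w ->
  (twin_multiple_count d N w)%:R <=
   N.+1%:R * (expR (expR 48) * (125 * singular d / ln (sieve_lim t)%:R ^+ 3))
   + (sieve_lim t ^ 8)%N%:R :> R.
Proof.
move=> d0 t0 tw.
have inS p : p \in primes_in 8 (sieve_lim t) -> prime p /\ (8 < p)%N by rewrite mem_primes_in => /and3P[].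
have := @brun_hooley R (twin_residues d) (sieve_blocks t) N.+1.
rewrite /= flatten_sieve_blocks => bh.
apply: le_trans (le_trans (bh _ _ _ _) _).
- rewrite ler_nat; apply: leq_sum => m _; case: andP => //= -[wm tm].
  rewrite lt0b; apply/allP => p; rewrite mem_primes_in => /and3P[pp _ pl].
  apply: twin_multiple_sifted => //; rewrite -(ltr_nat R); apply: le_lt_trans wm.
  by apply: le_trans tw; rewrite ler_nat.
- exact: uniq_primes_in.
- by move=> p /inS[].
- by move=> p /inS[? ?]; exact: twin_residues_uniq.
- by move=> b /mapP[j _ ->]; rewrite /= odd_double.
apply: lerD (sieve_error_le _ _ _); apply: ler_wpM2l => //.
apply: le_trans (sieve_main_le _ _ _) _; apply: ler_wpM2l; first exact: expR_ge0.
exact: sieve_density_prod_le.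
Qed.

(** The count of primes [P] in [(w, N]] with [6dP - 1] and [6dP + 1] prime, uniformly
    in [d]. *)
Lemma twin_sieve : exists2 K : R, 0 < K & forall d N (w : R), (0 < d)%N -> 1 < w -> w <= N%:R ->
  (twin_multiple_count d N w)%:R <= K * singular d * N%:R / ln w ^+ 3.
Proof.
set E := expR (expR 48 : R); have E0 : 0 < E by exact: expR_gt0.
(* The threshold enters through an equation, so that this large number stays unevaluated. *)
have [W0 W0E] : exists W0, W0 = (sieve_lim 1 ^ 16)%N by eexists.
set l1 := ln W0%:R : R; have l10 : 0 <= l1 by exact: lnn_ge0.
have c32 : 0 <= 32 ^+ 3 :> R by rewrite exprn_ge0.
exists (2 * l1 ^+ 3 + (2 * (E * 125) + 1) * 32 ^+ 3).
  by apply: ltr_wpDl; rewrite ?mulr_ge0 ?exprn_ge0 // mulr_gt0 ?exprn_gt0 // addr_gt0 // !mulr_gt0.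
move=> d N w d0 w1 wN.
have lw : 0 < ln w by exact: ln_gt0.
have w0 : 0 < w by exact: lt_trans w1.
have g1 := singular_ge1 d; have g0 : 0 <= singular d by exact: le_trans g1.
have N1 : 1 <= N%:R :> R by apply: le_trans wN; exact: ltW.
have N0 : 0 <= N%:R :> R by [].
have NS : N.+1%:R <= 2 * N%:R :> R by rewrite -natr1; lra.
have gN : 0 <= singular d * N%:R by exact: mulr_ge0.
have Ng : N%:R <= singular d * N%:R by exact: ler_peMl.
rewrite ler_pdivlMr ?exprn_gt0 //.
(* Below the threshold the logarithm is bounded and counting all integers suffices. *)
have [small|large] := ltP w W0%:R.
  have lwl : ln w <= l1 by rewrite ler_ln ?posrE ?(ltW small) //; exact: lt_trans small.
  have l3 : ln w ^+ 3 <= l1 ^+ 3 by rewrite lerXn2r ?nnegrE // ltW.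
  have cN : (twin_multiple_count d N w)%:R <= 2 * N%:R :> R.
    apply: le_trans NS; rewrite ler_nat /twin_multiple_count.
    rewrite -[leqRHS]card_ord -sum1_card; apply: leq_sum => m _; by case: (_ && _).
  apply: (@le_trans _ _ (2 * N%:R * l1 ^+ 3)).
    by apply: ler_pM => //; rewrite exprn_ge0 // ltW.
  have : 0 <= l1 ^+ 3 by rewrite exprn_ge0.
  move: (l1 ^+ 3) => L L0; rewrite -mulrA mulrDl mulrAC.
  have h1 := ler_wpM2l (mulr_ge0 (ler0n R 2) L0) Ng.
  have h2 : 0 <= (2 * (E * 125) + 1) * 32 ^+ 3 * (singular d * N%:R).
    by rewrite !mulr_ge0 // addr_ge0 // !mulr_ge0 // ltW.
  lra.
rewrite W0E in large; have [t t0 /andP[tw wt]] := sieve_level large; clear W0E large.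
set Z := sieve_lim t in tw wt *.
have Z8 : (8 <= Z)%N := sieve_lim_ge8 t.
have Z0 : 0 < Z%:R :> R by rewrite ltr0n (leq_trans _ Z8).
have Z1 : 1 < Z%:R :> R by rewrite ltr1n (leq_trans _ Z8).
have lZ : 0 < ln (Z%:R : R) by rewrite ln_gt0.
have Zw : Z%:R <= w.
  by apply: le_trans tw; rewrite (natrX _ Z 16) -[leLHS]expr1 ler_weXn2l // ltW.
have cnt := @sieve_count_le d t N w d0 t0 Zw.
have lwZ : ln w <= 32 * ln Z%:R.
  rewrite mulr_natl -lnXn // ler_ln ?posrE ?exprn_gt0 //.
  by rewrite -(natrX _ Z 32) ltW.
have l3 : ln w ^+ 3 <= 32 ^+ 3 * ln Z%:R ^+ 3.
  by rewrite -exprMn lerXn2r ?nnegrE ?mulr_ge0 // ltW.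
apply: le_trans (ler_wpM2r (exprn_ge0 3 (ltW lw)) cnt) _.
rewrite -/E -/Z mulrDl.
have main : N.+1%:R * (E * (125 * singular d / ln Z%:R ^+ 3)) * ln w ^+ 3 <=
   2 * (E * 125) * 32 ^+ 3 * (singular d * N%:R).
  apply: (@le_trans _ _ (N.+1%:R * (E * (125 * singular d / ln Z%:R ^+ 3)) * (32 ^+ 3 * ln Z%:R ^+ 3))).
    by apply: ler_wpM2l l3; rewrite !mulr_ge0 ?invr_ge0 ?exprn_ge0 // ltW.
  have -> : N.+1%:R * (E * (125 * singular d / ln Z%:R ^+ 3)) * (32 ^+ 3 * ln Z%:R ^+ 3) =
     E * 125 * 32 ^+ 3 * singular d * N.+1%:R by field; rewrite gt_eqF.
  have := @ler_wpM2l R (E * 125 * 32 ^+ 3 * singular d) _ _ _ NS.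
  rewrite !mulr_ge0 ?(ltW E0) // => /(_ isT) h; apply: le_trans h _; lra.
have err : (Z ^ 8)%N%:R * ln w ^+ 3 <= 32 ^+ 3 * (singular d * N%:R).
  apply: (@le_trans _ _ ((Z ^ 8)%N%:R * (32 ^+ 3 * ln Z%:R ^+ 3))).
    by apply: ler_wpM2l l3; exact: ler0n.
  rewrite mulrCA; apply: ler_wpM2l => //; apply: le_trans Ng; apply: le_trans wN.
  apply: le_trans tw; rewrite (natrX _ Z 8) (natrX _ Z 16).
  apply: (@le_trans _ _ (Z%:R ^+ 8 * Z%:R ^+ 3)).
    apply: ler_wpM2l; first by rewrite exprn_ge0.
    by rewrite lerXn2r ?nnegrE ?(ltW lZ) ?ltW // ln_sublinear.
  by rewrite -exprD ler_weXn2l // ltW.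
have l30 : 0 <= 2 * l1 ^+ 3 * (singular d * N%:R) by rewrite !mulr_ge0 ?exprn_ge0.
lra.
Qed.
End TwinSieve.

(** * Rankin weights *)

Section Rankin.
Variable R : realType.

(** The summand of the cofactor sum, [singular d / d], with Rankin's weight
    [d ^ delta]. *)
Definition rankin (delta : R) (d : nat) : R := singular R d * (d%:R `^ delta / d%:R).

Lemma rankin_ge0 delta d : 0 <= rankin delta d.
Proof.
rewrite /rankin mulr_ge0 ?divr_ge0 ?powR_ge0 //.
exact: le_trans (singular_ge1 R d).
Qed.

Lemma rankin1 delta : rankin delta 1 = 1.
Proof. by rewrite /rankin /singular big_nil powR1 divr1 mulr1. Qed.

Lemma rankinM delta p a d : prime p -> (0 < a)%N -> ~~ (p %| d)%N ->
  rankin delta (p ^ a * d) = rankin delta (p ^ a) * rankin delta d.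
Proof.
move=> pp a0 pd; have d0 : (0 < d)%N by case: posnP pd => // ->; rewrite dvdn0.
rewrite /rankin /singular (perm_big _ (primes_primeX_mul pp a0 d0 pd)) big_cons.
rewrite /= primesX // (primes_prime pp) big_seq1 natrM powRM // invfM.
by rewrite !mulrA; ring.
Qed.

Lemma powR_exprn (x r : R) a : 0 <= x -> (x ^+ a) `^ r = (x `^ r) ^+ a.
Proof.
move=> x0; elim: a => [|a IH]; first by rewrite !expr0 powR1.
by rewrite !exprS powRM ?exprn_ge0 // IH.
Qed.

Lemma rankinX delta p a : prime p -> (0 < a)%N ->
  rankin delta (p ^ a) = (1 + 6 / p%:R) * (p%:R `^ delta / p%:R) ^+ a.
Proof.
move=> pp a0; rewrite /rankin /singular primesX // primes_prime // big_seq1.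
by rewrite natrX powR_exprn // expr_div_n.
Qed.

Lemma ln2_ge_half : 1 / 2 <= ln (2 : R).
Proof. by have := @ln_le_lnln R 1 2 ltr01 (ler1n R 2); rewrite ln1 => ?; lra. Qed.

(** Properties of [q = p ^ (delta - 1)], the ratio of the geometric series of
    Rankin weights at [p]. The last bound keeps a factor [p ^ (- 1/4)] beyond the
    summable [p ^ (- 3/2)]: prime powers with exponent at least two have to be
    smaller than the main term by a power of [p]. *)
Lemma rankin_ratio_le (delta : R) p : 0 <= delta <= 1 / 8 -> (1 < p)%N ->
  [/\ 0 <= p%:R `^ delta / p%:R <= 3 / 4, p%:R^-1 <= p%:R `^ delta / p%:R :> R
   & (p%:R `^ delta / p%:R) ^+ 2 <= (p%:R `^ (- (1 / 4))) * (p%:R * Num.sqrt p%:R)^-1 :> R].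
Proof.
move=> /andP[d0 d8] p1; have p0 : 0 < p%:R :> R by rewrite ltr0n ltnW.
have p2 : 2 <= p%:R :> R by rewrite ler_nat.
have p1R : 1 <= p%:R :> R by rewrite ler1n ltnW.
have pd : p%:R `^ delta <= p%:R `^ (1 / 8) by apply: ler_powR.
split.
- rewrite divr_ge0 ?powR_ge0 //= ler_pdivrMr //; apply: le_trans pd _.
  have h0 : 0 < p%:R `^ (1 / 8) :> R by rewrite powR_gt0.
  have h8 : (p%:R `^ (1 / 8)) ^+ 8 = p%:R :> R.
    rewrite -powR_mulrn ?powR_ge0 // -powRrM -[RHS]powRr1 //.
    by congr (_ `^ _); lra.
  rewrite leNgt; apply/negP => h.
  have : (3 / 4 * p%:R) ^+ 8 < p%:R :> R.
    by rewrite -[ltRHS]h8 ltrXn2r // ?nnegrE ?ltW // mulr_gt0 // divr_gt0.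
  apply/negP; rewrite -leNgt exprMn [p%:R ^+ 8]exprS mulrCA -[leLHS]mulr1.
  apply: ler_wpM2l; first exact: ltW.
  have : 2 ^+ 7 <= p%:R ^+ 7 :> R by rewrite lerXn2r ?nnegrE // ltW.
  move: (p%:R ^+ 7) => y hy; apply: (@le_trans _ _ ((3 / 4) ^+ 8 * 2 ^+ 7)); first lra.
  by apply: ler_wpM2l => //; rewrite exprn_ge0 // divr_ge0.
- rewrite -[leLHS]mul1r ler_wpM2r ?invr_ge0 // -[leLHS](powRr0 p%:R).
  exact: ler_powR.
rewrite expr_div_n -powR12_sqrt // -powR_mulrn ?powR_ge0 // -powRrM.
have e : p%:R `^ (1 / 4) * p%:R `^ (- (1 / 4)) = 1 :> R.
  by rewrite -powRD ?subrr ?powRr0 // (gt_eqF p0) implybT.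
have e2 : p%:R `^ 2^-1 = p%:R `^ (1 / 4) * p%:R `^ (1 / 4) :> R.
  rewrite -powRD; last by rewrite (gt_eqF p0) implybT.
  by congr (_ `^ _); lra.
have h4 : p%:R `^ (delta * 2%:R) <= p%:R `^ (1 / 4) by apply: ler_powR => //; lra.
have q0 : 0 < p%:R `^ (1 / 4) :> R by rewrite powR_gt0.
have -> : p%:R `^ (- (1 / 4)) = (p%:R `^ (1 / 4))^-1 :> R by rewrite powRN.
rewrite e2; move: h4 q0; set A := p%:R `^ (delta * _); set B := p%:R `^ (1 / 4) => h4 B0.
have half : B * B * (B * B) = p%:R.
  rewrite -e2 -powRD; last by rewrite (gt_eqF p0) implybT.
  by rewrite -[RHS]powRr1 //; congr (_ `^ _); lra.
rewrite ler_pdivrMr ?exprn_gt0 //.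
have -> : B^-1 * (p%:R * (B * B))^-1 * p%:R ^+ 2 = B; last by [].
by rewrite -half; field; rewrite gt_eqF.
Qed.

(** Comparison of [n ^ (- 3/2)] with the telescoping differences of
    [- 2 / sqrt n]. *)
Lemma sum_inv_sqrt3_le s N : uniq s -> (forall p, p \in s -> (0 < p <= N)%N) ->
  \sum_(p <- s) (p%:R * Num.sqrt p%:R)^-1 <= 3 :> R.
Proof.
move=> us hs.
apply: (@le_trans _ _ (\sum_(1 <= p < N.+1) (p%:R * Num.sqrt p%:R)^-1)).
  rewrite (perm_big [seq p <- index_iota 1 N.+1 | p \in s]) /=; last first.
    apply: uniq_perm; rewrite ?filter_uniq ?iota_uniq // => p.
    rewrite mem_filter mem_index_iota ltnS; apply/idP/idP => [ps|/andP[]//].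
    by rewrite ps hs.
  rewrite big_filter big_mkcond /=; apply: ler_sum => p _; case: ifP => // _.
  by rewrite invr_ge0 mulr_ge0 // sqrtr_ge0.
case: N {us hs} => [|N]; first by rewrite big_nil.
suff h : \sum_(1 <= p < N.+2) (p%:R * Num.sqrt p%:R)^-1 <= 3 - 2 / Num.sqrt N.+1%:R :> R.
  by apply: le_trans h _; rewrite gerBl divr_ge0 // sqrtr_ge0.
elim: N => [|N IH]; first by rewrite big_nat1 sqrtr1 mulr1 invr1; lra.
rewrite big_nat_recr //=; set a := Num.sqrt N.+1%:R in IH *; set b := Num.sqrt N.+2%:R.
have a0 : 0 < a by rewrite sqrtr_gt0 ltr0n.
have b0 : 0 < b by rewrite sqrtr_gt0 ltr0n.
have aa : a ^+ 2 = N.+1%:R by rewrite sqr_sqrtr.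
have bb : b ^+ 2 = N.+2%:R by rewrite sqr_sqrtr.
have ab : b ^+ 2 = a ^+ 2 + 1 by rewrite aa bb -natr1.
have altb : a <= b by rewrite ler_sqrt // ler_nat.
apply: le_trans (lerD IH (lexx _)) _; rewrite -bb.
have h1 : 1 <= 2 * b * (b - a).
  have e : (b + a) * (b - a) = 1 by have := ab; lra.
  by rewrite -[leLHS]e; apply: ler_wpM2r; lra.
have h2 : 0 <= 2 * b ^+ 2 * (b - a) - a.
  have := ler_wpM2l (ltW b0) h1; rewrite mulr1 expr2 => ?; lra.
have : 0 <= (2 * b ^+ 2 * (b - a) - a) / (a * b ^+ 3).
  by rewrite divr_ge0 // mulr_ge0 ?exprn_ge0 ?ltW.
have -> : (2 * b ^+ 2 * (b - a) - a) / (a * b ^+ 3) = 2 / a - 2 / b - (b ^+ 2 * b)^-1.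
  by field; rewrite !gt_eqF.
lra.
Qed.

Lemma geometric_tail_le (q : R) X : 0 <= q <= 3 / 4 ->
  \sum_(a < X | (1 < a)%N) q ^+ a <= 4 * q ^+ 2.
Proof.
move=> /andP[q0 q1].
case: X => [|[|n]]; rewrite big_mkcond.
- by rewrite big_ord0 mulr_ge0 ?exprn_ge0.
- by rewrite big_ord_recl big_ord0 /= addr0 mulr_ge0 ?exprn_ge0.
rewrite !big_ord_recl /= !add0r.
rewrite (eq_bigr (fun i : 'I_n => q ^+ 2 * q ^+ i)); last by move=> i _; rewrite -exprD.
rewrite -mulr_sumr mulrC ler_wpM2r ?exprn_ge0 //.
have := subrX1 q n; set S := \sum_(_ < _) _ => e.
have qn : 0 <= q ^+ n by rewrite exprn_ge0.
have : (1 - q) * S <= 1 by lra.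
have S0 : 0 <= S by apply: sumr_ge0 => i _; rewrite exprn_ge0.
have := ler_wpM2r S0 (_ : 1 / 4 <= 1 - q); lra.
Qed.

(** As [delta * ln p] stays bounded, [p ^ delta] is [1 + O(delta * ln p)]; everything
    else in the local sum is of order [q ^ 2], hence summable over [p]. *)
Lemma rankin_prime_sum_le delta p X : 0 <= delta <= 1 / 8 -> prime p ->
  delta * ln p%:R <= 1 / 2 ->
  \sum_(a < X.+1 | (0 < a)%N) rankin delta (p ^ a) <=
    p%:R^-1 + 2 * delta * (ln p%:R / p%:R) + 22 * (p%:R * Num.sqrt p%:R)^-1.
Proof.
move=> dd pp dl; have p1 := prime_gt1 pp.
have p0 : 0 < p%:R :> R by rewrite ltr0n prime_gt0.
have [/andP[q0 q1] pq qq] := rankin_ratio_le dd p1.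
have qE : p%:R `^ delta / p%:R <= p%:R^-1 + 2 * delta * (ln p%:R / p%:R).
  have -> : p%:R^-1 + 2 * delta * (ln p%:R / p%:R) = (1 + 2 * (delta * ln p%:R)) / p%:R by ring.
  rewrite ler_wpM2r ?invr_ge0 //.
  have t0 : 0 <= delta * ln p%:R by rewrite mulr_ge0 ?lnn_ge0 //; case/andP: dd.
  have -> : p%:R `^ delta = expR (delta * ln p%:R) by rewrite /powR gt_eqF.
  move: t0 dl; set t := _ * ln _ => t0 t1.
  have := expR_ge1Dx (- t); rewrite expRN => h.
  have e0 := expR_gt0 t.
  have : (1 + - t) * expR t <= 1 by rewrite -ler_pdivlMr // mul1r.
  by move: e0; set E := expR t => e0 h1; nra.
set q := _ / p%:R in q0 q1 pq qq qE.
rewrite (eq_bigr (fun a : 'I__ => (1 + 6 / p%:R) * q ^+ a)); last by move=> a a0; rewrite rankinX.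
rewrite -mulr_sumr.
have qs : \sum_(a < X.+1 | (0 < a)%N) q ^+ a <= q + 4 * q ^+ 2.
  apply: le_trans (_ : \sum_(a < X.+2 | (0 < a)%N) q ^+ a <= _).
    by rewrite [leRHS]big_mkcond big_ord_recr /= -big_mkcond /= lerDl exprn_ge0.
  rewrite (bigID (fun a : 'I__ => (1 < a)%N)) /= addrC; apply: lerD.
    rewrite (big_pred1 (inord 1)) ?inordK ?expr1 // => a /=.
    by rewrite -val_eqE /= inordK //; case: (nat_of_ord a) => [|[|]].
  rewrite (eq_bigl (fun a : 'I__ => (1 < a)%N)); first exact: geometric_tail_le (introT andP (conj q0 q1)).
  by move=> a /=; case: (nat_of_ord a).
have sq : (p%:R `^ (- (1 / 4))) <= 1 :> R.
  by rewrite -[leRHS](powRr0 p%:R) ler_powR // ?ler1n ?prime_gt0 //; lra.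
have sqr0 : 0 <= (p%:R * Num.sqrt p%:R)^-1 :> R by rewrite invr_ge0 mulr_ge0 // sqrtr_ge0.
have qq' : q ^+ 2 <= (p%:R * Num.sqrt p%:R)^-1.
  by apply: le_trans qq _; exact: ler_piMl.
have p4 : 1 + 6 / p%:R <= 4 :> R.
  have : p%:R^-1 <= 2^-1 :> R by rewrite lef_pV2 ?posrE // ler_nat.
  lra.
have pinv0 : 0 <= p%:R^-1 :> R by rewrite invr_ge0.
apply: le_trans (ler_wpM2l (_ : 0 <= 1 + 6 / p%:R) qs) _; first lra.
move: qE qq' p4 pinv0 pq q0 q1; set z := (_ * _)^-1; set y := p%:R^-1; set u := 2 * delta * _.
move=> h1 h2 h3 h4 h5 h6 h7.
have e1 : y * q <= q ^+ 2 by rewrite expr2 ler_wpM2r.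
have e2 : (1 + 6 * y) * (4 * q ^+ 2) <= 4 * (4 * q ^+ 2) by rewrite ler_wpM2r // mulr_ge0 ?exprn_ge0.
rewrite mulrDr; nra.
Qed.

(** By [mertens1] the sum of [delta * ln p / p] over [p <= Y] is
    [delta * ln Y + O(1)], so the Rankin weight changes the bound of Mertens by a
    constant only. *)
Lemma rankin_smooth_sum : exists2 C : R, 0 < C & forall delta X Y k,
  0 <= delta <= 1 / 8 -> (1 < Y)%N -> delta * ln Y%:R <= 1 / 2 ->
  exists2 U : R, 0 <= U <= ln (ln Y%:R) + C &
  \sum_(d < X.+1 | smooth (primes_in 0 Y) d && (size (primes d) == k)) rankin delta d <=
    U ^+ k / k`!%:R.
Proof.
have [C0 HC0] := mertens2 R.
exists (`|C0| + ln 16%:R + 67); first by rewrite ltr_wpDl // addr_ge0 // lnn_ge0.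
move=> delta X Y k dd Y1 dY.
pose u p := \sum_(a < X.+1 | (0 < a)%N) rankin delta (p ^ a).
have u0 p : 0 <= u p by apply: sumr_ge0 => a _; exact: rankin_ge0.
exists (\sum_(p <- primes_in 0 Y) u p).
  rewrite sumr_ge0 //=.
  apply: (@le_trans _ _ (\sum_(p <- primes_in 0 Y)
     (p%:R^-1 + 2 * delta * (ln p%:R / p%:R) + 22 * (p%:R * Num.sqrt p%:R)^-1))).
    rewrite big_seq [leRHS]big_seq; apply: ler_sum => p; rewrite mem_primes_in => /and3P[pp p0 pY].
    apply: rankin_prime_sum_le => //; apply: le_trans dY; apply: ler_wpM2l; first by case/andP: dd.
    by rewrite ler_ln ?posrE ?ltr0n ?ler_nat // (leq_trans p0).
  rewrite !big_split /= -!mulr_sumr.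
  have s1 := HC0 Y Y1; have s2 := @mertens1 R Y (ltnW Y1).
  have s3 : \sum_(p <- primes_in 0 Y) (p%:R * Num.sqrt p%:R)^-1 <= 3 :> R.
    apply: (@sum_inv_sqrt3_le _ Y); first exact: uniq_primes_in.
    by move=> p; rewrite mem_primes_in => /and3P[_ -> ->].
  rewrite -/(prime_recip_sum R 0 Y) -/(mertens_sum R Y).
  have l16 := lnn_ge0 R 16.
  have h : delta * mertens_sum R Y <= 1 / 2 + 1 / 8 * ln 16%:R.
    case/andP: dd => d0 d8; apply: le_trans (ler_wpM2l d0 s2) _; rewrite mulrDr.
    by apply: lerD => //; exact: ler_wpM2r.
  have := ler_norm C0; lra.
apply: le_trans (@smooth_sum_omega _ (primes_in 0 Y) X k (rankin delta) _ _ _ _ _) _.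
- by move=> p; rewrite mem_primes_in => /andP[].
- exact: uniq_primes_in.
- exact: rankin_ge0.
- exact: rankin1.
- by move=> p a d; rewrite mem_primes_in => /andP[pp _]; exact: rankinM.
apply: le_trans (elem_sym_le _ _) _; first by move=> x /mapP[p _ ->]; exact: u0.
by rewrite big_map.
Qed.
End Rankin.

(** * Summation over the largest prime *)

Section Cofactor.
Variable R : realType.

Definition twin_index (m : nat) : bool := prime (6 * m).-1 && prime (6 * m).+1.

(** The conditions on [P ^ a] in [m = d * P ^ a]. Primality of [6m - 1] and [6m + 1]
    is only recorded for [a = 1], where the sieve applies. *)
Definition good_power (d M P a : nat) : bool :=
  [&& (0 < a)%N, (d * P ^ a <= M)%N & (a == 1)%N ==> twin_multiple d P].

Lemma powRN_quarter_le (w : R) : 1 < w -> w `^ (- (1 / 4)) <= 384 / ln w ^+ 3.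
Proof.
move=> w1; have w0 : 0 < w by exact: lt_trans w1.
have lw : 0 < ln w by exact: ln_gt0.
rewrite powRN -[leRHS]invrK lef_pV2 ?posrE ?powR_gt0 ?invr_gt0 ?divr_gt0 ?exprn_gt0 //.
rewrite invf_div /powR gt_eqF //.
have := @exprn_fact_le R (1 / 4 * ln w) 3; rewrite mulr_ge0 ?divr_ge0 ?(ltW lw) // => /(_ isT).
apply: le_trans; rewrite exprMn (_ : 3`! = 6)%N //; lra.
Qed.

(** The first power contributes at most 2, because [P ^ delta <= exp (1 / 2)]. For
    the higher ones, [d * P ^ a <= M] is used as the bound [1 <= M / (d * P ^ a)]. *)
Lemma prime_power_sum_le P d M (delta w : R) Y : prime P -> (0 < d)%N ->
  0 <= delta <= 1 / 8 -> 1 < w -> w < P%:R -> (P <= Y)%N -> delta * ln Y%:R <= 1 / 2 ->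
  \sum_(a < M.+1 | good_power d M P a) (P ^ a)%N%:R `^ delta <=
    2 * ((d * P <= M)%N && twin_multiple d P : nat)%:R +
    M%:R / d%:R * (4 * (w `^ (- (1 / 4)) * (P%:R * Num.sqrt P%:R)^-1)).
Proof.
move=> pP d0 dd w1 wP PY dY.
have p1 := prime_gt1 pP; have P0 : 0 < P%:R :> R by rewrite ltr0n ltnW.
have d0R : 0 < d%:R :> R by rewrite ltr0n.
have delta0 : 0 <= delta by case/andP: dd.
have [/andP[q0 q1] pq qq] := rankin_ratio_le dd p1.
set q := P%:R `^ delta / P%:R in q0 q1 pq qq.
rewrite (bigID (fun a : 'I__ => (1 < a)%N)) /= addrC; apply: lerD.
  apply: (@le_trans _ _ (\sum_(a < M.+1 | (nat_of_ord a == 1)%N)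
      2 * ((d * P <= M)%N && twin_multiple d P : nat)%:R)).
    rewrite big_mkcond [leRHS]big_mkcond; apply: ler_sum => a _.
    rewrite /good_power; case: (nat_of_ord a) => [|[|n]] //=; rewrite ?andbF // expn1 andbT.
    case: ifP => _; last by rewrite mulr_ge0.
    rewrite mulr1 /powR gt_eqF //.
    have h : delta * ln P%:R <= 1 / 2.
      apply: le_trans dY; apply: ler_wpM2l => //.
      by rewrite ler_ln ?posrE ?ltr0n ?ler_nat // ?(leq_trans _ PY) // ltnW.
    have := expR_ge1Dx (- (delta * ln P%:R)); rewrite expRN => h1.
    have : (1 - delta * ln P%:R) * expR (delta * ln P%:R) <= 1 by rewrite -ler_pdivlMr ?expR_gt0 // mul1r.
    have := expR_gt0 (delta * ln P%:R); move: (expR _) => E E0 h2; nra.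
  case: M => [|M]; first by rewrite big1 ?mulr_ge0 // => -[[]].
  rewrite (big_pred1 (inord 1)) // => a /=; by rewrite -val_eqE /= inordK.
apply: (@le_trans _ _ (\sum_(a < M.+1 | (1 < a)%N) (M%:R / d%:R * q ^+ a))).
  rewrite big_mkcond [leRHS]big_mkcond; apply: ler_sum => a _; rewrite andbC.
  case: ifP => [/andP[a1 /and3P[_ dPM _]]|_]; last first.
    case: ifP => _ //; apply: mulr_ge0; first exact: divr_ge0.
    exact: exprn_ge0.
  rewrite a1.
  have -> : (P ^ a)%N%:R `^ delta = q ^+ a * P%:R ^+ a :> R.
    by rewrite natrX /q expr_div_n mulfVK ?expf_neq0 ?gt_eqF // powR_exprn // ltW.
  rewrite mulrC; apply: ler_wpM2r; first exact: exprn_ge0.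
  by rewrite ler_pdivlMr // -natrX -natrM ler_nat mulnC.
rewrite -mulr_sumr; apply: ler_wpM2l; first by rewrite divr_ge0.
apply: le_trans (geometric_tail_le _ (introT andP (conj q0 q1))) _.
apply: ler_wpM2l => //; apply: le_trans qq _; apply: ler_wpM2r.
  by rewrite invr_ge0 mulr_ge0 // sqrtr_ge0.
rewrite !powRN lef_pV2 ?posrE ?powR_gt0 //; last exact: lt_trans w1.
have w0 : 0 < w by exact: lt_trans w1.
by apply: ge0_ler_powR; rewrite ?nnegrE ?ltW // ?divr_gt0 //.
Qed.

(** Sieve bound for [a = 1]; for [a >= 2] the factor [w ^ (- 1/4)] of the previous
    lemma is dominated by [1 / (ln w) ^ 3]. *)
Lemma twin_cofactor_sum : exists2 K : R, 0 < K & forall d M Y (delta w : R),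
  (0 < d)%N -> 0 <= delta <= 1 / 8 -> delta * ln Y%:R <= 1 / 2 -> 1 < w ->
  \sum_(P < M.+1 | [&& prime P, w < P%:R & (P <= Y)%N])
    \sum_(a < M.+1 | good_power d M P a) (P ^ a)%N%:R `^ delta <=
  K * singular R d * (M%:R / d%:R) / ln w ^+ 3.
Proof.
have [K K0 HK] := twin_sieve R.
exists (2 * K + 12 * 384); first by rewrite addr_gt0 ?mulr_gt0.
move=> d M Y delta w d0 dd dY w1.
have d0R : 0 < d%:R :> R by rewrite ltr0n.
have lw : 0 < ln w by exact: ln_gt0.
have g1 := singular_ge1 R d; have g0 : 0 <= singular R d by exact: le_trans g1.
have Md0 : 0 <= M%:R / d%:R :> R by rewrite divr_ge0.
apply: (@le_trans _ _ (\sum_(P < M.+1 | [&& prime P, w < P%:R & (P <= Y)%N])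
   (2 * ((d * P <= M)%N && twin_multiple d P : nat)%:R +
    M%:R / d%:R * (4 * (w `^ (- (1 / 4)) * (P%:R * Num.sqrt P%:R)^-1))))).
  by apply: ler_sum => P /and3P[pP wP PY]; exact: prime_power_sum_le PY dY.
rewrite big_split /=.
have part1 : \sum_(P < M.+1 | [&& prime P, w < P%:R & (P <= Y)%N])
    2 * ((d * P <= M)%N && twin_multiple d P : nat)%:R <=
    2 * K * singular R d * (M%:R / d%:R) / ln w ^+ 3.
  have -> : 2 * K * singular R d * (M%:R / d%:R) / ln w ^+ 3 =
     2 * (K * singular R d * (M%:R / d%:R) / ln w ^+ 3) by ring.
  rewrite -mulr_sumr; apply: ler_wpM2l => //.
  set N := (M %/ d)%N.
  have NM : N%:R <= M%:R / d%:R :> R by rewrite ler_pdivlMr // -natrM ler_nat leq_divM.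
  apply: (@le_trans _ _ (twin_multiple_count d N w)%:R).
    rewrite -natr_sum ler_nat /twin_multiple_count.
    rewrite (big_ord_widen M.+1 (fun m => ((w < m%:R)%R && twin_multiple d m : nat))); last first.
      by rewrite ltnS leq_div.
    rewrite big_mkcond [leqRHS]big_mkcond; apply: leq_sum => P _.
    case: ifP => // /and3P[_ -> _]; rewrite ltnS leq_divRL // mulnC.
    by case: (P * d <= M)%N; rewrite /= ?leqnn.
  (* The sieve requires w <= N; otherwise no P is counted. *)
  have [wN|Nw] := leP w N%:R.
    apply: le_trans (HK d N w d0 w1 wN) _.
    rewrite ler_wpM2r ?invr_ge0 ?exprn_ge0 ?(ltW lw) // ler_wpM2l // mulr_ge0 // ltW //.
  have -> : twin_multiple_count d N w = 0%N; last first.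
    by rewrite divr_ge0 ?exprn_ge0 ?(ltW lw) // mulr_ge0 // mulr_ge0 // ltW.
  apply: big1 => m _; case: andP => // -[wm _].
  have : m%:R <= N%:R :> R by rewrite ler_nat -ltnS.
  by move=> /(lt_le_trans wm) /(lt_trans Nw); rewrite ltxx.
have part2 : \sum_(P < M.+1 | [&& prime P, w < P%:R & (P <= Y)%N])
    M%:R / d%:R * (4 * (w `^ (- (1 / 4)) * (P%:R * Num.sqrt P%:R)^-1)) <=
    12 * 384 * singular R d * (M%:R / d%:R) / ln w ^+ 3.
  rewrite -mulr_sumr -mulr_sumr -mulr_sumr.
  have s3 : \sum_(P < M.+1 | [&& prime P, w < P%:R & (P <= Y)%N]) (P%:R * Num.sqrt P%:R)^-1 <= 3 :> R.
    rewrite -(big_mkord (fun P => [&& prime P, w < P%:R & (P <= Y)%N]) (fun P => (P%:R * Num.sqrt P%:R)^-1)).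
    rewrite -big_filter; apply: (@sum_inv_sqrt3_le _ _ M); first by rewrite filter_uniq // iota_uniq.
    move=> p; rewrite mem_filter mem_index_iota => /andP[/andP[pp _] /andP[_ pM]].
    by rewrite prime_gt0 // -ltnS.
  have s0 : 0 <= \sum_(P < M.+1 | [&& prime P, w < P%:R & (P <= Y)%N]) (P%:R * Num.sqrt P%:R)^-1 :> R.
    by apply: sumr_ge0 => P _; rewrite invr_ge0 mulr_ge0 // sqrtr_ge0.
  have l0 : 0 <= 384 / ln w ^+ 3 by rewrite divr_ge0 // exprn_ge0 // ltW.
  have h : w `^ (- (1 / 4)) * \sum_(P < M.+1 | [&& prime P, w < P%:R & (P <= Y)%N]) (P%:R * Num.sqrt P%:R)^-1
     <= 384 / ln w ^+ 3 * 3.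
    by apply: ler_pM => //; [exact: powR_ge0|exact: powRN_quarter_le].
  apply: (@le_trans _ _ (M%:R / d%:R * (4 * (384 / ln w ^+ 3 * 3)))).
    by apply: ler_wpM2l => //; exact: ler_wpM2l.
  have -> : 12 * 384 * singular R d * (M%:R / d%:R) / ln w ^+ 3 =
     singular R d * (M%:R / d%:R * (4 * (384 / ln w ^+ 3 * 3))) by ring.
  by apply: ler_peMl => //; rewrite mulr_ge0 // mulr_ge0 // mulr_ge0.
apply: le_trans (lerD part1 part2) _.
by rewrite le_eqVlt; apply/orP; left; apply/eqP; ring.
Qed.
End Cofactor.

(** * Summation over the cofactor *)

Section LargestPrime.
Variable R : realType.

Lemma max_pdiv_split m k : size (primes m) = k.+1 ->
  [/\ (1 < m)%N, prime (max_pdiv m), (0 < logn (max_pdiv m) m)%N,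
      (m`_(max_pdiv m)^' * max_pdiv m ^ logn (max_pdiv m) m = m)%N
    & size (primes (m`_(max_pdiv m)^')) = k].
Proof.
move=> sz; have m1 : (1 < m)%N by case: m sz => [|[|]].
have m0 := ltnW m1; have pP := max_pdiv_prime m1.
have l0 : (0 < logn (max_pdiv m) m)%N by rewrite logn_gt0 mem_primes pP m0 max_pdiv_dvd.
split => //; first by rewrite -p_part mulnC partnC.
have pd : ~~ (max_pdiv m %| m`_(max_pdiv m)^')%N.
  by rewrite -prime_coprime // (pnat_coprime (pnat_id pP)) // part_pnat.
have /perm_size := primes_primeX_mul pP l0 (part_gt0 _ m) pd.
by rewrite -p_part partnC // sz /= => -[].
Qed.

Lemma twin_multiple_of_index d P : prime P -> twin_index (d * P) -> twin_multiple d P.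
Proof. by move=> pP; rewrite /twin_index /twin_multiple pP mulnA. Qed.

(** The map from [m] to [(d, P, a)], with [P] the largest prime factor of [m], is
    injective; the inner sum over [(P, a)] is [twin_cofactor_sum], and the sum over
    [d] is the one of [rankin_smooth_sum]. The weight [m ^ delta] splits
    multiplicatively. *)
Lemma largest_prime_class_sum : exists2 C : R, 0 < C & exists2 K : R, 0 < K &
  forall (delta w : R) M Y k, 0 <= delta <= 1 / 8 -> (1 < Y)%N -> delta * ln Y%:R <= 1 / 2 -> 1 < w ->
  exists2 U : R, 0 <= U <= ln (ln Y%:R) + C &
  \sum_(m < M.+1 | [&& twin_index m, size (primes m) == k.+1, w < (max_pdiv m)%:R & (max_pdiv m <= Y)%N])
     m%:R `^ delta <= K * M%:R * (U ^+ k / k`!%:R) / ln w ^+ 3.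
Proof.
have [C C0 HC] := rankin_smooth_sum R; have [K K0 HK] := twin_cofactor_sum R.
exists C => //; exists K => // delta w M Y k dd Y1 dY w1.
have lw : 0 < ln w by exact: ln_gt0.
have [U U0 HU] := HC delta M Y k dd Y1 dY; exists U => //.
pose h (m : 'I_M.+1) : 'I_M.+1 * ('I_M.+1 * 'I_M.+1) :=
  (inord (m`_(max_pdiv m)^'), (inord (max_pdiv m), inord (logn (max_pdiv m) m))).
pose F (j : 'I_M.+1 * ('I_M.+1 * 'I_M.+1)) : R :=
  j.1%:R `^ delta * (j.2.1 ^ j.2.2)%N%:R `^ delta.
pose A (d : 'I_M.+1) := smooth (primes_in 0 Y) d && (size (primes d) == k).
pose B (P : 'I_M.+1) := [&& prime P, w < P%:R & (P <= Y)%N].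
pose D (d P a : 'I_M.+1) := good_power d M P a.
have hE (m : 'I_M.+1) : size (primes m) == k.+1 ->
   [/\ nat_of_ord (h m).1 = (m`_(max_pdiv m)^')%N, nat_of_ord (h m).2.1 = max_pdiv m
     & nat_of_ord (h m).2.2 = logn (max_pdiv m) m].
  move=> /eqP /max_pdiv_split[m1 pP l0 mE _]; have m0 := ltnW m1.
  split; rewrite /= inordK //; apply: leq_ltn_trans (ltn_ord m).
  - exact: dvdn_leq (dvdn_part _ _).
  - exact: dvdn_leq (max_pdiv_dvd _).
  - by apply: ltnW; apply: ltn_logl.
have hm (m : 'I_M.+1) : size (primes m) == k.+1 -> ((h m).1 * (h m).2.1 ^ (h m).2.2 = m)%N.
  by move=> sz; have [-> -> ->] := hE m sz; have /eqP/max_pdiv_split[] := sz.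
apply: (@le_trans _ _ (\sum_(j | A j.1 && (B j.2.1 && D j.1 j.2.1 j.2.2)) F j)).
  rewrite (eq_bigr (fun m => F (h m))); last first.
    move=> m /and4P[_ sz _ _]; rewrite /F -powRM // -natrM; congr (_ `^ _).
    by rewrite hm.
  apply: ler_sum_inj => [m n|m|j _].
  - move=> /and4P[_ szm _ _] /and4P[_ szn _ _] e; apply/val_inj => /=.
    by rewrite -(hm m szm) -(hm n szn) e.
  - move=> /and4P[tm sz wP PY]; have [e1 e2 e3] := hE m sz.
    have [m1 pP l0 mE sd] := max_pdiv_split (eqP sz).
    rewrite /A /B /D e1 e2 e3 sd eqxx pP wP PY /= andbT.
    have -> : smooth (primes_in 0 Y) (m`_(max_pdiv m)^').
      rewrite /smooth part_gt0; apply/allP => q; rewrite primes_part mem_filter => /andP[_ qm].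
      rewrite /= mem_primes_in; have := qm; rewrite mem_primes => /and3P[pq _ _].
      by rewrite pq prime_gt0 //= (leq_trans _ PY) // max_pdiv_max.
    rewrite /good_power l0 mE -ltnS ltn_ord /=; apply/implyP => /eqP l1.
    by apply: twin_multiple_of_index => //; move: mE; rewrite l1 expn1 => ->.
  - by rewrite mulr_ge0 ?powR_ge0.
rewrite -(pair_big_dep A (fun d u => B u.1 && D d u.1 u.2) (fun d u => F (d, u))) /=.
apply: (@le_trans _ _ (\sum_(d | A d) (K * M%:R / ln w ^+ 3) * rankin delta d)).
  apply: ler_sum => d /andP[/andP[d0 _] _].
  rewrite -(pair_big_dep B (fun P a => D d P a) (fun P a => F (d, (P, a)))) /F /=.
  under eq_bigr do rewrite -mulr_sumr.
  rewrite -mulr_sumr.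
  apply: le_trans (ler_wpM2l (powR_ge0 _ _) (HK d M Y delta w d0 dd dY w1)) _.
  by rewrite le_eqVlt /rankin; apply/orP; left; apply/eqP; ring.
rewrite -mulr_sumr.
have -> : K * M%:R * (U ^+ k / k`!%:R) / ln w ^+ 3 = K * M%:R / ln w ^+ 3 * (U ^+ k / k`!%:R) by ring.
by apply: ler_wpM2l HU; rewrite divr_ge0 ?exprn_ge0 ?(ltW lw) // mulr_ge0 // ltW.
Qed.
End LargestPrime.

(** * Dyadic classes of the largest prime factor *)

Section Classes.
Variable R : realType.

Lemma twin_count_le (k : nat) (x : R) :
  (twin_count k x <= \sum_(m < (Num.truncn x).+1) (twin_index m && (size (primes m) == k)))%N.
Proof.
set M := Num.truncn x.
pose s2 := [seq (6 * m)%N | m <- iota 0 M.+1 & twin_index m && (size (primes m) == k)].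
apply: (@leq_trans (size s2)).
  apply: uniq_leq_size; first exact: fset_uniq.
  move=> n nS; have : n \in twin_middle k x.
    by have := in_fset_set (finite_twin_middle k x) n => <-.
  move=> /set_mem[n4 nx pm pp om].
  have d6 := twin_middle_dvd6 n4 pm pp; have nE : (6 * (n %/ 6) = n)%N by rewrite mulnC divnK.
  apply/mapP; exists (n %/ 6)%N => //; rewrite mem_filter mem_iota /= add0n ltnS.
  rewrite subn1 in pm; rewrite addn1 in pp.
  rewrite /twin_index nE pm pp -/(omega _) om eqxx /=.
  apply: leq_trans (leq_div n 6) _.
  by rewrite truncn_ge_nat // (le_trans _ nx).
rewrite size_map size_filter -sum1_count.
rewrite -(big_mkord xpredT (fun m => twin_index m && (size (primes m) == k) : nat)).
by rewrite big_mkcond /index_iota subn0; apply: leq_sum => m _; case: (_ && _).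
Qed.

Lemma expRN_le_pow4 (t : R) : 0 < t -> expR (- t) <= 24 / t ^+ 4.
Proof.
move=> t0; have := exprn_fact_le 4 (ltW t0); rewrite (_ : 4`! = 24)%N // => h.
rewrite expRN -[leRHS]invrK lef_pV2 ?posrE ?expR_gt0 ?invr_gt0 ?divr_gt0 ?exprn_gt0 //.
by rewrite invf_div.
Qed.

(** A dyadic localisation of the logarithm of the largest prime factor relative to
    [ln x]: on each class one exponent serves for Rankin's trick. *)
Definition in_class (x : R) (i m : nat) : bool :=
  (expR (ln x / 2 ^+ i.+1) < (max_pdiv m)%:R) && ((max_pdiv m)%:R <= expR (ln x / 2 ^+ i)).

Definition twin_class (x : R) (k i m : nat) : bool :=
  [&& twin_index m, size (primes m) == k.+1 & in_class x i m].

Lemma class_exists (x : R) m : 1 < x -> (1 < m)%N -> m%:R <= x ->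
  exists2 i, (i < (Num.truncn (2 * ln x)).+1)%N & in_class x i m.
Proof.
move=> x1 m1 mx; have x0 : 0 < x by exact: lt_trans x1.
have pP := max_pdiv_prime m1.
have P2 : 2 <= (max_pdiv m)%:R :> R by rewrite ler_nat prime_gt1.
pose p i := (max_pdiv m)%:R <= expR (ln x / 2 ^+ i).
have p0 : exists i, p i.
  exists 0%N; rewrite /p expr0 divr1 lnK ?posrE //; apply: le_trans mx.
  by rewrite ler_nat dvdn_leq ?max_pdiv_dvd // ltnW.
have pb i : p i -> (i <= Num.truncn (2 * ln x))%N.
  move=> /(le_trans P2) h; rewrite truncn_ge_nat; last by rewrite mulr_ge0 // ln_ge0 // ltW.
  have : ln 2 <= ln x / 2 ^+ i by rewrite -ler_expR lnK ?posrE.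
  move=> /(le_trans (ln2_ge_half R)); rewrite ler_pdivlMr ?exprn_gt0 // => h2.
  apply: (@le_trans _ _ (2 ^+ i)); last lra.
  by rewrite -natrX ler_nat ltnW // ltn_expl.
case: (ex_maxnP p0 pb) => i pi imax.
exists i; first by rewrite ltnS pb.
rewrite /in_class -/(p i) pi andbT ltNge; apply/negP => /imax; by rewrite ltnn.
Qed.

(** With [t = 2 ^ i], the sieve loses the factor [8 * t ^ 3] against
    [x / (ln x) ^ 3]. Indices [m] above the square root of [x] recover it from
    Rankin's factor, those below it from the saving of a square root; in both cases
    with an additional factor [1 / t], which makes the classes summable. *)
Lemma class_count_le : exists2 C : R, 0 < C & exists2 K : R, 0 < K & forall (x : R) k i, 2 <= x ->
  \sum_(m < (Num.truncn x).+1 | twin_class x k i m) 1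
   <= K * x * ((ln (ln x) + C) ^+ k / (k`!%:R * ln x ^+ 3)) * 2^-1 ^+ i.
Proof.
have [C C0 [K K0 HK]] := largest_prime_class_sum R.
exists (C + 1); first by rewrite addr_gt0.
exists (K * (192 * 32 ^+ 4 + 8 * 6144)); first by rewrite mulr_gt0 // addr_gt0 ?mulr_gt0 ?exprn_gt0.
move=> x k i x2; have x0 : 0 < x by exact: lt_le_trans x2.
set L := ln x; set M := Num.truncn x.
have L2 : ln 2 <= L by rewrite ler_ln ?posrE.
have lh := ln2_ge_half R.
have L0 : 0 < L by lra.
set t : R := 2 ^+ i; have t0 : 0 < t by rewrite exprn_gt0.
have t1 : 1 <= t by rewrite exprn_ege1 // ler1n.
have tS : 2 ^+ i.+1 = 2 * t by rewrite exprS.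
have L30 : 0 < L ^+ 3 by rewrite exprn_gt0.
(* The summand 1 added to C keeps the base of the power nonnegative at x = 2. *)
have llx : 0 <= ln L + (C + 1).
  have : ln (1 / 2) <= ln L by rewrite ler_ln ?posrE ?divr_gt0 //; lra.
  rewrite mul1r lnV ?posrE //.
  have := @le_ln1Dx R 1 (lt_trans (ltrN10 _) ltr01); rewrite (_ : 1 + 1 = 2) // => ? ?; lra.
set T := (ln L + (C + 1)) ^+ k / k`!%:R.
have T0 : 0 <= T by rewrite divr_ge0 ?exprn_ge0.
have -> : K * (192 * 32 ^+ 4 + 8 * 6144) * x * ((ln L + (C + 1)) ^+ k / (k`!%:R * L ^+ 3)) * 2^-1 ^+ i
   = K * T / L ^+ 3 * ((192 * 32 ^+ 4 + 8 * 6144) * x / t).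
  rewrite /T /t exprVn; field; rewrite !gt_eqF //; last by rewrite ltr0n fact_gt0.
have KTL : 0 <= K * T / L ^+ 3 by rewrite divr_ge0 ?(ltW L30) // mulr_ge0 // ltW.
(* The class is empty unless exp(L / t), which bounds a prime, is at least 2. *)
have [small|large] := ltP (L / t) (ln 2).
  rewrite big1; last first.
    move=> m /and3P[_ sz /andP[_ Pm]]; have [m1 pP _ _ _] := max_pdiv_split (eqP sz).
    have : 2 <= expR (L / t) by apply: le_trans Pm; rewrite ler_nat prime_gt1.
    by rewrite -[X in X <= _]lnK ?posrE // ler_expR leNgt small.
  apply: mulr_ge0 KTL _; apply: divr_ge0 (ltW t0); apply: mulr_ge0 (ltW x0).
  by apply: addr_ge0; apply: mulr_ge0 => //; exact: exprn_ge0.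
pose w := expR (L / 2 ^+ i.+1); pose Y := Num.truncn (expR (L / t)).
have lnw : ln w = L / (2 * t) by rewrite /w expRK tS.
have w1 : 1 < w by rewrite expR_gt1 divr_gt0 ?exprn_gt0.
have YE n : (n <= Y)%N = (n%:R <= expR (L / t)) by rewrite /Y truncn_ge_nat ?expR_ge0.
have Y1 : (1 < Y)%N by rewrite YE -[leLHS]lnK ?posrE // ler_expR.
have lY : ln Y%:R <= L / t.
  rewrite -[leRHS]expRK ler_ln ?posrE ?expR_gt0 ?ltr0n ?(ltnW Y1) //.
  by rewrite -YE.
have lY0 : 0 < ln (Y%:R : R) by rewrite ln_gt0 // ltr1n.
have LtL : L / t <= L by rewrite ler_pdivrMr // ler_peMr // ltW.
have UT (U : R) : 0 <= U <= ln (ln Y%:R) + C -> U ^+ k / k`!%:R <= T.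
  move=> /andP[U0 U1]; apply: ler_wpM2r; first by rewrite invr_ge0.
  rewrite lerXn2r ?nnegrE //; apply: le_trans U1 _.
  have : ln (ln Y%:R) <= ln L by rewrite ler_ln ?posrE // (le_trans lY).
  lra.
(* Used twice: N = M with a positive exponent, and N = sqrt x with exponent 0. *)
have bound (delta : R) N : 0 <= delta <= 1 / 8 -> delta * (L / t) <= 1 / 2 ->
   \sum_(m < N.+1 | twin_class x k i m) m%:R `^ delta <=
   K * T / L ^+ 3 * (8 * t ^+ 3 * N%:R).
  move=> dd dL.
  have dY : delta * ln Y%:R <= 1 / 2.
    by apply: le_trans dL; apply: ler_wpM2l lY; case/andP: dd.
  have [U hU HU] := HK delta w N Y k dd Y1 dY w1.
  rewrite (eq_bigl (fun m : 'I_N.+1 => [&& twin_index m, size (primes m) == k.+1,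
      w < (max_pdiv m)%:R & (max_pdiv m <= Y)%N])); last first.
    by move=> m; rewrite /twin_class /in_class YE.
  apply: le_trans HU _; rewrite lnw.
  have -> : K * N%:R * (U ^+ k / k`!%:R) / (L / (2 * t)) ^+ 3 =
     K / L ^+ 3 * (8 * t ^+ 3 * N%:R) * (U ^+ k / k`!%:R).
    by field; rewrite !gt_eqF // ?ltr0n ?fact_gt0.
  have -> : K * T / L ^+ 3 * (8 * t ^+ 3 * N%:R) = K / L ^+ 3 * (8 * t ^+ 3 * N%:R) * T by ring.
  apply: ler_wpM2l (UT U hU).
  by rewrite !mulr_ge0 ?invr_ge0 ?exprn_ge0 ?(ltW K0) ?(ltW L0) ?(ltW t0).
rewrite (bigID (fun m : 'I_M.+1 => m%:R <= expR (L / 2))) /=.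
have xE : expR (L / 2) * expR (L / 2) = x.
  rewrite -expRD (_ : L / 2 + L / 2 = L) ?lnK ?posrE //; lra.
have h0 := expR_gt0 (L / 2).
have part1 : \sum_(m < M.+1 | twin_class x k i m && (m%:R <= expR (L / 2))) 1
   <= K * T / L ^+ 3 * (8 * 6144 * x / t).
  pose N := Num.truncn (expR (L / 2)).
  have NE n : (n <= N)%N = (n%:R <= expR (L / 2)) by rewrite /N truncn_ge_nat ?expR_ge0.
  have NM : (N <= M)%N.
    rewrite /M truncn_ge_nat ?(ltW x0) // -xE; apply: (@le_trans _ _ (expR (L / 2))); first by rewrite -NE.
    by rewrite ler_peMr ?(ltW h0) // ltW // expR_gt1 divr_gt0.
  have d00 : 0 <= (0 : R) <= 1 / 8 by apply/andP; split; lra.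
  have d01 : 0 * (L / t) <= 1 / 2 by rewrite mul0r; lra.
  have := bound 0 N d00 d01.
  under eq_bigr do rewrite powRr0.
  rewrite (big_ord_widen_cond M.+1 (fun m => twin_class x k i m)
     (fun=> 1)) ?ltnS // => bN.
  rewrite (eq_bigl (fun m : 'I_M.+1 => twin_class x k i m && (m < N.+1)%N)).
    apply: le_trans bN _; apply: ler_wpM2l => //.
    have Nh : N%:R <= expR (L / 2) by rewrite -NE.
    have tL : t <= 2 * L.
      move: large; rewrite ler_pdivlMr // => large.
      have := ler_wpM2r (ltW t0) lh; lra.
    (* exp(L / 2) absorbs t^4 <= (2 L)^4; here 6144 = 16 * 16 * 4!. *)
    have t4 : t ^+ 4 <= (2 * L) ^+ 4 by rewrite lerXn2r ?nnegrE ?mulr_ge0 // ltW.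
    have L4 : (L / 2) ^+ 4 / 24 <= expR (L / 2).
      by have := @exprn_fact_le R (L / 2) 4; rewrite (_ : 4`! = 24)%N //; apply; rewrite divr_ge0 // ltW.
    rewrite ler_pdivlMr //.
    have -> : 8 * t ^+ 3 * N%:R * t = 8 * (t ^+ 4 * N%:R) by ring.
    rewrite -xE -mulrA [leRHS]mulrA -mulrA; apply: ler_wpM2l => //.
    rewrite mulrA; apply: ler_pM => //; first by rewrite exprn_ge0 // ltW.
    apply: le_trans t4 _; move: L4.
    have -> : (2 * L) ^+ 4 = 6144 * ((L / 2) ^+ 4 / 24) by field.
    by move=> L4; apply: ler_wpM2l.
  by move=> m; rewrite ltnS NE.
have part2 : \sum_(m < M.+1 | twin_class x k i m && ~~ (m%:R <= expR (L / 2))) 1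
   <= K * T / L ^+ 3 * (192 * 32 ^+ 4 * x / t).
  (* x^(-delta / 2) = exp(- t / 32), and 24 / u^4 bounds exp(- u): this beats t^3. *)
  pose delta := t / (16 * L).
  have dL : delta * (L / t) = 1 / 16 by rewrite /delta; field; rewrite !gt_eqF.
  have dd : 0 <= delta <= 1 / 8.
    rewrite /delta divr_ge0 ?mulr_ge0 ?(ltW t0) ?(ltW L0) //= ler_pdivrMr ?mulr_gt0 //.
    move: large; rewrite ler_pdivlMr // => large.
    have := ler_wpM2r (ltW t0) lh; lra.
  have dL2 : delta * (L / t) <= 1 / 2 by rewrite dL; lra.
  have bM := bound delta M dd dL2.
  apply: (@le_trans _ _ (expR (- (t / 32)) * \sum_(m < M.+1 |
     twin_class x k i m) m%:R `^ delta)).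
    rewrite mulr_sumr big_mkcondr /=; apply: ler_sum => m _.
    case: ifPn => [|_]; last by rewrite mulr_ge0 ?expR_ge0 ?powR_ge0.
    rewrite -ltNge => hm; have m0 : 0 < (m%:R : R) by exact: lt_trans hm.
    rewrite /powR gt_eqF // -expRD -[leLHS]expR0 ler_expR.
    have lm : L / 2 <= ln m%:R by rewrite -ler_expR lnK ?posrE // ltW.
    have := ler_wpM2l (proj1 (andP dd)) lm.
    have -> : delta * (L / 2) = t / 32 by rewrite /delta; field; rewrite gt_eqF.
    by rewrite addrC subr_ge0.
  apply: le_trans (ler_wpM2l (expR_ge0 _) bM) _.
  rewrite mulrCA; apply: ler_wpM2l => //.
  have t32 : 0 < t / 32 by rewrite divr_gt0.
  have Mx : M%:R <= x by rewrite -truncn_ge_nat // ltW.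
  apply: (@le_trans _ _ (24 / (t / 32) ^+ 4 * (8 * t ^+ 3 * x))).
    apply: ler_pM; rewrite ?expR_ge0 ?mulr_ge0 ?exprn_ge0 ?(ltW t0) // ?expRN_le_pow4 //.
    by apply: ler_wpM2l => //; rewrite mulr_ge0 // exprn_ge0 // ltW.
  by rewrite le_eqVlt; apply/orP; left; apply/eqP; field; rewrite gt_eqF.
apply: le_trans (lerD part1 part2) _.
by rewrite le_eqVlt; apply/orP; left; apply/eqP; field; rewrite !gt_eqF.
Qed.

End Classes.

(** * The count of twin middles *)

Unset Implicit Arguments.

Theorem corollary4 (R : realType) :
  exists K C : R, [/\ 0 < K, 0 < C &
    forall (k : nat) (x : R), (0 < k)%N -> 2 <= x ->
      (twin_count k x)%:R <=
        K * x * ((ln (ln x) + C) ^+ (k - 1) / ((k - 1)`!%:R * ln x ^+ 3))].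
Proof.
have [C C0 [K K0 HK]] := class_count_le R.
exists (K * 2), C; split => //; first exact: mulr_gt0.
move=> [//|k] x _ x2; rewrite subn1 /=.
set B := _ / (_ * _).
have x1 : 1 < x by apply: lt_le_trans x2; rewrite ltr1n.
have KB : 0 <= K * x * B.
  have := HK x k 0%N x2; rewrite expr0 mulr1; apply: le_trans.
  by apply: sumr_ge0.
set I := (Num.truncn (2 * ln x)).+1.
apply: (@le_trans _ _ (\sum_(0 <= i < I) (K * x * B) * 2^-1 ^+ i)); last first.
  have -> : K * 2 * x * B = (K * x * B) * 2 by ring.
  rewrite -mulr_sumr; apply: ler_wpM2l => //.
  have i0 : 0 <= (2^-1 : R) ^+ I by rewrite exprn_ge0 // invr_ge0.
  rewrite big_mkord; move: (subrX1 (2^-1 : R) I) i0; clear.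
  by move: (\sum_(_ < _) _) (_ ^+ _) => S z; lra.
apply: (@le_trans _ _ (\sum_(0 <= i < I)
  \sum_(m < (Num.truncn x).+1 | twin_class x k i m) 1)); last first.
  by apply: ler_sum => i _; exact: HK.
have := twin_count_le k.+1 x; rewrite -(ler_nat R) natr_sum; move/le_trans; apply.
under [leRHS]eq_bigr do rewrite big_mkcond.
rewrite exchange_big /=; apply: ler_sum => m _.
have s0 : 0 <= \sum_(0 <= i < I) (if twin_class x k i m then 1 else 0 : R).
  by apply: sumr_ge0 => i _; case: ifP.
case: (boolP (twin_index m && (size (primes m) == k.+1))) => // /andP[tm sz].
have [m1 _ _ _ _] := max_pdiv_split (eqP sz).
have mx : m%:R <= x.
  have : (m <= Num.truncn x)%N by rewrite -ltnS ltn_ord.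
  by rewrite truncn_ge_nat // (le_trans ler01 (ltW x1)).
have [i iI ci] := class_exists x1 m1 mx.
have im : i \in index_iota 0 I by rewrite mem_index_iota.
rewrite (bigD1_seq i im (iota_uniq _ _)) /= {1}/twin_class tm sz ci lerDl.
by apply: sumr_ge0 => j _; case: ifP.
Qed.
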